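(* Let $m\ge2$ and let $\mathcal{H}\in\mathcal{P}(\mathcal{H})$ be a connected bicyclic linear $m$-uniform hypergraph with $k$ edges. Then: (a) $\lambda_1(\mathcal{H})\le\lambda_1(BC(k-6))$, and equality holds only when $\mathcal{H}=BC(k-6)$. (b) $\lambda_1(BC(k-6))=|\beta|/(m-1)$, where $\beta$ is the root with the largest modulus of the polynomial equation (in $\lambda$) $$\big(\lambda(\lambda-m+2)(\lambda-m+3)-(k-6)(m-1)(\lambda-m+3)-4(m-2)(\lambda-m+2)\big)\big(\lambda^2-(m-2)\lambda-2m+3\big)-4(\lambda+1)^2(\lambda-m+2)=0,$$ and $$\frac{m-2+\sqrt{(m-2)^2+4(k-2)(m-1)}}{2}<|\beta|<\frac{m+2+\sqrt{(m+2)^2+4(k-2)(m-1)}}{2}.$$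
   Context: A hypergraph has a finite vertex set and an edge set of non-empty subsets of the vertex set; it is $m$-uniform if all edges have cardinality $m$, and linear if two distinct edges share at most one vertex. The adjacency matrix of a linear $m$-uniform hypergraph has $(i,j)$ entry $\frac{1}{m-1}$ if $i\ne j$ lie in a common edge, and $0$ otherwise; $\lambda_1$ denotes the spectral radius of this matrix. The $m$-th power hypergraph of a graph $G(V,E)$ is the $m$-uniform hypergraph obtained by adding to each edge $e\in E$ $m-2$ new vertices $v_{e,1},\dots,v_{e,m-2}$ (distinct for distinct edges). $\mathcal{P}(\mathcal{H})$ denotes the set of $m$-th power hypergraphs of graphs (a fixed notation for the set, not depending on the particular hypergraph $\mathcal{H}$). A loose cycle of length $l\ge3$, $v_1e_1v_2e_2\dots v_le_lv_1$, is the $m$-uniform hypergraph with edges $e_1,\dots,e_l$ in which $e_{i-1}\cap e_i=\{v_i\}$ (indices mod $l$, the $v_i$ distinct) and non-consecutive edges are disjoint; $v_1,\dots,v_l$ are its core vertices. A linear hypergraph is bicyclic if it contains exactly two loose cycles. Attaching a pendant edge at a vertex $v$ means adding a new edge consisting of $v$ and $m-1$ new vertices. $BC(l_1)$ is the linear hypergraph obtained by joining two loose cycles of length $3$ by identifying one core vertex of each, and attaching $l_1$ pendant edges at the identified vertex. Equality of hypergraphs means isomorphism. *)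

(* Defs.v *)
From HB Require Import structures.
From mathcomp Require Import all_boot all_order all_algebra.

Set Implicit Arguments.
Unset Strict Implicit.
Unset Printing Implicit Defensive.

Import Order.TTheory GRing.Theory Num.Theory.
Local Open Scope ring_scope.

Record hypergraph := Hypergraph {
  vertex :> finType;
  edges : {set {set vertex}};
  edges_neq0 : set0 \notin edges }.

Definition uniform (m : nat) (H : hypergraph) : Prop :=
  forall e : {set H}, e \in edges H -> #|e| = m.

Definition linear_hypergraph (H : hypergraph) : Prop :=
  forall e f : {set H},
    e \in edges H -> f \in edges H -> e != f -> (#|e :&: f| <= 1)%N.

Definition coedge (H : hypergraph) : rel H :=
  [rel x y | [exists e in edges H, (x \in e) && (y \in e)]].
Arguments coedge : clear implicits.

Definition connected_hypergraph (H : hypergraph) : Prop :=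
  forall x y : H, connect (coedge H) x y.

Definition hypergraph_iso (H1 H2 : hypergraph) : Prop :=
  exists2 f : H1 -> H2, bijective f &
    forall e : {set H1}, (f @: e \in edges H2) = (e \in edges H1).

(* [C] is the edge set of a loose cycle [v_0 e_0 v_1 e_1 ... v_(l-1) e_(l-1) v_0];
   [ordS] and [ord_pred] are the cyclic successor and predecessor on ['I_l]. *)
Definition is_loose_cycle (T : finType) (C : {set {set T}}) : Prop :=
  exists (l : nat) (e : 'I_l -> {set T}) (v : 'I_l -> T),
    [/\ (3 <= l)%N, injective e /\ C = [set e i | i : 'I_l], injective v,
        forall i : 'I_l, e (ord_pred i) :&: e i = [set v i] &
        forall i j : 'I_l, j != i -> j != ordS i -> i != ordS j ->
          [disjoint e i & e j]].

(* A loose cycle of [H] is identified with its set of edges, so that rotations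
   and reversals of the same cyclic sequence are not counted separately. *)
Definition bicyclic (H : hypergraph) : Prop :=
  exists C1 C2 : {set {set H}},
    C1 != C2 /\
    forall C : {set {set H}},
      (C \subset edges H /\ is_loose_cycle C) <-> (C = C1 \/ C = C2).

Lemma setU1_neq0 (T : finType) (x : T) (A : {set T}) : x |: A != set0.
Proof. by apply/set0Pn; exists x; rewrite setU11. Qed.

Section PowerHypergraph.
Variables (m : nat) (G : hypergraph).

Definition power_vertex : finType :=
  (G + {e : {set G} | e \in edges G} * 'I_(m - 2))%type.

Definition power_edge (e : {e : {set G} | e \in edges G}) : {set power_vertex} :=
  [set inl x | x in val e] :|: [set inr (e, i) | i : 'I_(m - 2)].

Fact power_edges_neq0 : set0 \notin [set power_edge e | e in predT].
Proof.
apply/imsetP => -[e _ /esym /eqP]; rewrite setU_eq0 imset_eq0 => /andP[/eqP e0 _].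
by have /negP := edges_neq0 G; rewrite -e0; apply; apply: valP.
Qed.

Definition power_hypergraph : hypergraph := Hypergraph power_edges_neq0.

End PowerHypergraph.

(* A simple graph is a 2-uniform hypergraph. *)
Definition is_power_hypergraph (m : nat) (H : hypergraph) : Prop :=
  exists2 G : hypergraph, uniform 2 G & hypergraph_iso H (power_hypergraph m G).

Section LooseCycle.
Variables m l : nat.

Definition cycle_vertex : finType := ('I_l + 'I_l * 'I_(m - 2))%type.

Definition cycle_edge (i : 'I_l) : {set cycle_vertex} :=
  inl i |: (inl (ordS i) |: [set inr (i, j) | j : 'I_(m - 2)]).

Fact cycle_edges_neq0 : set0 \notin [set cycle_edge i | i in predT].
Proof. by apply/imsetP => -[i _ /esym /eqP]; apply/negP/setU1_neq0. Qed.

Definition loose_cycle : hypergraph := Hypergraph cycle_edges_neq0.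

End LooseCycle.

(* The disjoint union of [H1] and [H2] with [x1] and [x2] identified. *)
Section Coalescence.
Variables (H1 H2 : hypergraph) (x1 : H1) (x2 : H2).

Definition coalescence_vertex : finType := (H1 + {y : H2 | y != x2})%type.

Definition coalescence_inr (y : H2) : coalescence_vertex :=
  if insub y is Some u then inr u else inl x1.

Definition coalescence_edges : {set {set coalescence_vertex}} :=
  [set [set inl x | x in e] | e : {set H1} in edges H1]
  :|: [set coalescence_inr @: e | e : {set H2} in edges H2].

Fact coalescence_edges_neq0 : set0 \notin coalescence_edges.
Proof.
rewrite inE; apply/norP; split; apply/imsetP => -[e eH /esym /eqP];
  rewrite imset_eq0 => /eqP e0; rewrite e0 in eH;
  by [have := edges_neq0 H1; rewrite eH | have := edges_neq0 H2; rewrite eH].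
Qed.

Definition coalescence : hypergraph := Hypergraph coalescence_edges_neq0.

End Coalescence.

Section AttachPendant.
Variables (m : nat) (H : hypergraph) (v : H) (n : nat).

Definition pendant_vertex : finType := (H + 'I_n * 'I_(m - 1))%type.

Definition pendant_edge (i : 'I_n) : {set pendant_vertex} :=
  inl v |: [set inr (i, j) | j : 'I_(m - 1)].

Definition attach_edges : {set {set pendant_vertex}} :=
  [set [set inl x | x in e] | e : {set H} in edges H]
  :|: [set pendant_edge i | i in predT].

Fact attach_edges_neq0 : set0 \notin attach_edges.
Proof.
rewrite inE; apply/norP; split; apply/imsetP => -[e eH /esym /eqP].
  rewrite imset_eq0 => /eqP e0; rewrite e0 in eH.
  by have := edges_neq0 H; rewrite eH.
by apply/negP/setU1_neq0.
Qed.

(* [H] with [n] pendant edges of cardinality [m] attached at [v]. *)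
Definition attach_pendant : hypergraph := Hypergraph attach_edges_neq0.

End AttachPendant.

(* By symmetry of the loose cycle, the choice of core vertex is immaterial. *)
Definition core0 (m : nat) : loose_cycle m 3 := inl ord0.

Definition BC (m l1 : nat) : hypergraph :=
  @attach_pendant m (coalescence (core0 m) (core0 m)) (inl (core0 m)) l1.

Section Spectrum.
(* [C] stands for the complex numbers; [x <= y] between elements of [C] entails
   that [y - x] is a nonnegative real. *)
Variable C : numClosedFieldType.

Definition adjacency (m : nat) (H : hypergraph) : 'M[C]_#|H| :=
  \matrix_(i, j) (if (i != j) && coedge H (enum_val i) (enum_val j)
                  then (m%:R - 1)^-1 else 0).

(* The maximum is over the roots of the characteristic polynomial, that is, over
   the eigenvalues of [A]; see [spectral_radiusP]. *)
Definition spectral_radius (n : nat) (A : 'M[C]_n) : C :=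
  \big[Num.max/0]_(z <- sval (closed_field_poly_normal (char_poly A))) `|z|.

Definition lambda1 (m : nat) (H : hypergraph) : C :=
  spectral_radius (adjacency m H).

Lemma spectral_radiusP (n : nat) (A : 'M[C]_n) : (0 < n)%N ->
  (exists2 z, eigenvalue A z & `|z| = spectral_radius A) /\
  (forall z, eigenvalue A z -> `|z| <= spectral_radius A).
Proof.
rewrite /spectral_radius; case: closed_field_poly_normal => r /= defp n0.
have memr z : eigenvalue A z = (z \in r).
  rewrite eigenvalue_root_char defp rootZ ?root_prod_XsubC //.
  by rewrite lead_coef_eq0 monic_neq0 // char_poly_monic.
have sizer : size r = n.
  have := size_char_poly A; rewrite defp (monicP (char_poly_monic A)) scale1r.
  by rewrite size_prod_XsubC => -[].
have real0 s : \big[Num.max/0]_(z <- s) `|z : C| \is Num.real.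
  by elim: s => [|z s IH]; rewrite ?big_nil ?real0 // big_cons max_real ?normr_real.
split=> [|z]; last first.
  rewrite memr; elim: r {defp memr sizer} => // x s IH.
  rewrite in_cons big_cons comparable_le_max ?real_comparable ?normr_real //.
  by case/orP=> [/eqP->|/IH->]; rewrite ?lexx ?orbT.
suff /(_ r) : forall s : seq C, s != [::] ->
    exists2 z, z \in s & `|z| = \big[Num.max/0]_(z <- s) `|z|.
  by rewrite -size_eq0 sizer -lt0n => /(_ n0)[z zr <-]; exists z; rewrite ?memr.
elim=> // x s IH _; rewrite big_cons.
have [->|s0] := eqVneq s [::].
  exists x; rewrite ?mem_head // big_nil /Order.max ifN //.
  by rewrite normr_lt0.
have [y ys <-] := IH s0; rewrite /Order.max; case: ifP => _.
  by exists y => //; rewrite in_cons ys orbT.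
by exists x; rewrite ?mem_head.
Qed.

Definition BC_poly (m k : nat) (lam : C) : C :=
  (lam * (lam - m%:R + 2) * (lam - m%:R + 3)
     - (k%:R - 6) * (m%:R - 1) * (lam - m%:R + 3)
     - 4 * (m%:R - 2) * (lam - m%:R + 2))
    * (lam ^+ 2 - (m%:R - 2) * lam - 2 * m%:R + 3)
  - 4 * (lam + 1) ^+ 2 * (lam - m%:R + 2).

(* [beta] is a root of [p] of largest modulus; this determines [`|beta|]. *)
Definition largest_root (p : C -> C) (beta : C) : Prop :=
  p beta = 0 /\ forall z, p z = 0 -> `|z| <= `|beta|.

End Spectrum.

(* Main.v *)
(* A Perron vector x of the power hypergraph H of G yields a test vector on
   BC.  Let u be a vertex of G of largest weight and take a breadth-first tree of
   G rooted at u.  A loose cycle is an even edge set and a fundamental cycle has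
   a single non-tree edge, so having exactly two loose cycles leaves exactly two
   non-tree edges; they avoid u because the tree is breadth-first, and they are
   disjoint because otherwise they would close up a third cycle.  Re-attaching
   every vertex of G to u, while keeping the two non-tree edges, turns H into BC
   on the same vertex set, and does not decrease the quadratic form of the
   adjacency matrix at x; comparing the eigenvalue equations at u shows that it
   increases the spectral radius unless nothing was moved.  For BC, eliminating the
   entries of a Perron vector produces the quintic, and every root of the quintic
   is either exceptional, and then small, or an eigenvalue of (m - 1) times the
   adjacency matrix. *)
Require Import Defs.
From mathcomp Require Import all_boot all_order all_algebra.
From mathcomp Require Import ring zify.
Import Order.TTheory GRing.Theory Num.Theory.

Set Implicit Arguments.
Unset Strict Implicit.
Unset Printing Implicit Defensive.

(** * Power hypergraphs indexed by the edges of the graph *)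

(** Write [N] for the sum of a vector over the new vertices of an edge with ends [a] and [b]. That
    edge contributes [2 * (x a + N) * (x b + N)] to the quadratic form, plus terms free of the ends,
    so exchanging [b] for a vertex of [G] of largest weight cannot decrease it. This is why the
    maximum is taken over the vertices of [G] and why re-attachment moves one end of an edge at a
    time. Both edge sets are indexed by the vertices other than [u], through their parent edges,
    plus two further indices.

    Each forbidden configuration, be it a third non-tree edge or two non-tree edges with a common
    end, is excluded by exhibiting three pairwise distinct loose cycles.

    The order on [C] is partial, so Perron vectors are obtained from norms: a unitary
    diagonalization bounds the adjacency operator by its largest eigenvalue modulus.

    The two bounds on the root [r] come from one quantity, [r * (r - m + 2) - (k - 2) * (m - 1)],
    which vanishes at the radius, scaled by [m - 1], of the power of a star with [k - 2] edges. The
    quintic shows that it lies strictly between [0] and [4 * r]. *)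

Section EdgeIndexedPower.
Variables (m : nat) (V I : finType) (a b : I -> V).

(** The type does not depend on [a] and [b]: moving the ends of edges leaves the vertices in place,
    so one vector can be tested on two hypergraphs. *)
Definition ipower_vertex : finType := (V + I * 'I_(m - 2))%type.

Definition in_ipower_edge (i : I) (z : ipower_vertex) : bool :=
  match z with
  | inl v => (v == a i) || (v == b i)
  | inr q => q.1 == i
  end.

Definition ipower_edge (i : I) : {set ipower_vertex} :=
  [set z | in_ipower_edge i z].

Fact ipower_edges_neq0 : set0 \notin [set ipower_edge i | i in predT].
Proof.
apply/imsetP => -[i _ /setP /(_ (inl (a i)))].
by rewrite !inE /= eqxx.
Qed.

Definition ipower : hypergraph := Hypergraph ipower_edges_neq0.

Definition simple_ends : Prop :=
  (forall i, a i != b i) /\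
  (forall i j, [set a i; b i] = [set a j; b j] -> i = j).

Lemma ipower_edgesP (e : {set ipower}) :
  reflect (exists i, e = ipower_edge i) (e \in edges ipower).
Proof.
by apply: (iffP imsetP) => [[i _ ->]|[i ->]]; exists i.
Qed.

Lemma coedge_ipower (v w : ipower) :
  coedge ipower v w = [exists i, in_ipower_edge i v && in_ipower_edge i w].
Proof.
apply/existsP/existsP => [[e /andP[/ipower_edgesP [i ->]]]|[i vw]].
  by rewrite !inE => vw; exists i.
by exists (ipower_edge i); rewrite imset_f //= !inE.
Qed.

Hypothesis ab_simple : simple_ends.

(** A new vertex determines its edge, and two old vertices are the two ends of theirs. This is
    linearity in the form that later splits neighbor sums edge by edge without double counting. *)
Lemma ipower_edge_uniq (i j : I) (v w : ipower) : v != w ->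
    in_ipower_edge i v -> in_ipower_edge i w ->
    in_ipower_edge j v -> in_ipower_edge j w -> i = j.
Proof.
have [_ ab_inj] := ab_simple.
case: v w => [v|[i1 k1]] [w|[i2 k2]] /= vw; try by do ?move/eqP=> ?; congruence.
have vw' : v != w by apply: contraNneq vw => ->.
have endsE k : (v == a k) || (v == b k) -> (w == a k) || (w == b k) ->
    [set a k; b k] = [set v; w].
  move=> /orP[] /eqP vE /orP[] /eqP wE; move: vw'; rewrite vE wE ?eqxx //.
  by rewrite setUC.
move=> vi wi vj wj; apply: ab_inj.
by rewrite (endsE i vi wi) (endsE j vj wj).
Qed.

Lemma ipower_edge_inj : injective ipower_edge.
Proof.
have [ab_neq _] := ab_simple.
move=> i j eqij.
have inj_ z : in_ipower_edge i z -> in_ipower_edge j z.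
  by move/setP: eqij => /(_ z); rewrite !inE => ->.
have ia : in_ipower_edge i (inl (a i)) by rewrite /= eqxx.
have ib : in_ipower_edge i (inl (b i)) by rewrite /= eqxx orbT.
apply: (ipower_edge_uniq _ ia ib (inj_ _ ia) (inj_ _ ib)).
by apply: contraNneq (ab_neq i) => -[->].
Qed.

End EdgeIndexedPower.

(** * Trees, cycles and the structure of bicyclic power hypergraphs *)

(** [d] is the least length of a walk from [u], and [p v] is the last vertex but one of a shortest
    walk. The third property is the one special to breadth-first trees: no edge skips a level. *)
Lemma bfs_tree (T : finType) (e : rel T) (u : T) :
    symmetric e -> (forall v, connect e u v) ->
  exists (d : T -> nat) (p : T -> T),
    [/\ d u = 0%N, forall v, v != u -> e v (p v) /\ d v = (d (p v)).+1 &
        forall v w, e v w -> (d v <= (d w).+1)%N].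
Proof.
move=> e_sym e_conn.
pose reach n v := [exists s : n.-tuple T, path e u s && (last u s == v)].
have reachP n v : reflect (exists s, [/\ size s = n, path e u s & last u s = v])
    (reach n v).
  apply: (iffP existsP) => [[s /andP[us /eqP sv]]|[s [sn us sv]]].
    by exists s; rewrite size_tuple.
  have sn' : size s == n by rewrite sn.
  by exists (Tuple sn'); rewrite /= us sv eqxx.
have reach_ex v : exists n, reach n v.
  have /connectP [s us ->] := e_conn v.
  by exists (size s); apply/reachP; exists s.
pose d v := ex_minn (reach_ex v).
have d_reach v : reach (d v) v by rewrite /d; case: ex_minnP.
have d_le n v : reach n v -> (d v <= n)%N.
  by rewrite /d; case: ex_minnP => k _; apply.
have d_edge v w : e v w -> (d v <= (d w).+1)%N.
  move=> vw; apply: d_le; have /reachP [s [sd us sw]] := d_reach w.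
  apply/reachP; exists (rcons s v).
  by rewrite size_rcons sd rcons_path us sw e_sym vw last_rcons.
have d_u : d u = 0%N.
  by apply/eqP; rewrite -leqn0; apply: d_le; apply/reachP; exists [::].
have [p pE] : exists p : T -> T, forall v, v != u ->
    e v (p v) /\ d v = (d (p v)).+1.
  apply: (fin_all_exists (P := fun v w => v != u -> e v w /\ d v = (d w).+1)).
  move=> v; have [->|vu] := eqVneq v u; first by exists u.
  have /reachP [s [sd us sv]] := d_reach v.
  case/lastP: s sd us sv => [_ _ /esym/eqP|s w]; first by rewrite (negbTE vu).
  rewrite size_rcons rcons_path last_rcons => sd /andP[us sw] wv.
  rewrite {w}wv in sw; exists (last u s) => _; rewrite e_sym sw; split=> //.
  apply/eqP; rewrite eqn_leq d_edge ?(e_sym v) //= -sd ltnS.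
  by apply: d_le; apply/reachP; exists s.
by exists d, p.
Qed.

Lemma ordS_neq l (i : 'I_l) : (3 <= l)%N ->
  (ordS i != i) && (ordS (ordS i) != i).
Proof.
move=> l3; rewrite -!val_eqE /=.
have [il|] := ltnP i.+1 l.
  rewrite (modn_small il); have [il2|] := ltnP i.+2 l.
    by rewrite (modn_small il2); lia.
  move=> il2; have -> : i.+2 = l by lia.
  by rewrite modnn; lia.
move=> il; have iE : i.+1 = l by have := ltn_ord i; lia.
by rewrite iE modnn modn_small; lia.
Qed.

Lemma set2_eqP (T : finType) (x y z t : T) : [set x; y] = [set z; t] ->
  x = z /\ y = t \/ x = t /\ y = z.
Proof.
move=> /setP E; have := E x; have := E y; have := E z; have := E t.
rewrite !inE !eqxx ?orbT /= => /orP[]/eqP ? /orP[]/eqP ?;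
  by move=> /esym/orP[]/eqP ? /esym/orP[]/eqP ?; subst; auto.
Qed.

Section Cycles.
Variables (m : nat) (V I : finType) (a b : I -> V).
Hypothesis ab_simple : simple_ends a b.
Notation ends i := [set a i; b i].
Notation edge := (@ipower_edge m V I a b).

(** A cycle of the graph lifts to a loose cycle. The bound [3 <= l] enters through
    [ordS (ordS i) != i], which keeps an edge from being traversed in both directions. *)
Lemma loose_cycle_of_ends l (w : 'I_l -> V) (idx : 'I_l -> I) :
    (3 <= l)%N -> injective w ->
    (forall j, ends (idx j) = [set w j; w (ordS j)]) ->
  is_loose_cycle [set edge (idx j) | j : 'I_l].
Proof.
move=> l3 w_inj idxE; have [_ ab_inj] := ab_simple.
have S1 i : ordS i != i :> 'I_l by case/andP: (ordS_neq i l3).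
have S2 i : ordS (ordS i) != i :> 'I_l by case/andP: (ordS_neq i l3).
have idx_inj : injective idx.
  move=> i j ij; have := congr1 (fun k => ends k) ij; rewrite !idxE.
  case/set2_eqP => -[/w_inj // iE /w_inj jE].
  by have := S2 j; rewrite -iE jE eqxx.
have in_edge i z : (z \in edge (idx i)) =
    match z with inl v => (v == w i) || (v == w (ordS i)) | inr q => q.1 == idx i end.
  rewrite inE; case: z => [v|//] /=.
  by have /setP /(_ v) := idxE i; rewrite !inE.
exists l, (fun i => edge (idx i)), (fun i => inl (w i)); split=> //.
- by split=> // i j /(ipower_edge_inj ab_simple) /idx_inj.
- by move=> i j [] /w_inj.
- move=> i; have pS := ord_predK i; set j := ord_pred i in pS *.
  apply/setP => z; rewrite in_setI !in_edge in_set1; case: z => [v|[k n]] /=.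
    rewrite (inj_eq inl_inj) pS; have [->|vi] := eqVneq v (w i).
      by rewrite orbT.
    rewrite orbF; apply/negP => /andP[/eqP-> /eqP/w_inj jE].
    by have := S2 j; rewrite pS -jE eqxx.
  apply/negP => /andP[/eqP kj /eqP ki]; have := S1 j.
  by rewrite pS (idx_inj j i) ?eqxx // -kj -ki.
move=> i j ji jSi iSj; rewrite -setI_eq0; apply/eqP/setP => z.
rewrite in_setI !in_edge in_set0; case: z => [v|[k n]] /=; last first.
  by apply/negP => /andP[/eqP ki /eqP /=]; rewrite ki => /idx_inj/eqP;
    rewrite eq_sym (negbTE ji).
apply/negP => /andP[/orP[]/eqP-> /orP[]/eqP/w_inj/eqP].
- by rewrite eq_sym (negbTE ji).
- by rewrite (negbTE iSj).
- by rewrite eq_sym (negbTE jSi).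
by rewrite (inj_eq (@ordS_inj _)) eq_sym (negbTE ji).
Qed.

(** The edge [g] closes a simple path into a cycle. [P] records which edges the path may use, and
    the last clause identifies its first edge, as needed when that edge is prescribed. *)
Lemma path_loose_cycle (P : pred I) (x : V) (s : seq V) (g : I) :
    let e v w := [exists i, P i && (ends i == [set v; w])] in
    uniq (x :: s) -> path e x s -> (2 <= size s)%N ->
    ends g = [set x; last x s] ->
  exists C : {set {set ipower m a b}},
    [/\ C \subset edges (ipower m a b), is_loose_cycle C, edge g \in C,
        forall i, edge i \in C -> P i \/ i = g &
        forall i, ends i = [set x; head x s] -> edge i \in C].
Proof.
move=> e xs_uniq xs_path s2 gE; have [_ ab_inj] := ab_simple.
pose w (j : 'I_(size s).+1) := nth x (x :: s) j.
have w_inj : injective w.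
  by move=> i j /eqP; rewrite nth_uniq ?ltn_ord // => /eqP /val_inj.
have w0 : w ord0 = x by [].
have w_max : w ord_max = last x s by rewrite /w /= (last_nth x).
have S_max : ordS (ord_max : 'I_(size s).+1) = ord0.
  by apply: val_inj; rewrite /= modnn.
(* Every index but the last gives a path edge; the last one wraps around to [x] and gives [g]. *)
have idx_ex (j : 'I_(size s).+1) :
    exists i, ends i = [set w j; w (ordS j)] /\ (P i \/ i = g).
  have [js|] := ltnP j (size s).
    have /existsP [i /andP[Pi /eqP iE]] := pathP x xs_path j js.
    by exists i; split; [rewrite iE /w /= modn_small | left].
  move=> sj; have -> : j = ord_max.
    by apply: val_inj => /=; have := ltn_ord j; lia.
  by exists g; split; [rewrite S_max w0 w_max gE setUC | right].
have [idx idxE] := fin_all_exists idx_ex.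
have idx_edge i j : ends i = [set w j; w (ordS j)] -> i = idx j.
  by have [<- _] := idxE j; apply: ab_inj.
exists [set edge (idx j) | j : 'I_(size s).+1]; split.
- by apply/subsetP => _ /imsetP [j _ ->]; apply/ipower_edgesP; exists (idx j).
- by apply: (loose_cycle_of_ends (w := w)) => // j; have [] := idxE j.
- apply/imsetP; exists ord_max => //; congr (edge _); apply: idx_edge.
  by rewrite S_max w0 w_max gE setUC.
- move=> i /imsetP [j _ /(ipower_edge_inj ab_simple) ->].
  by have [] := idxE j.
move=> i iE; apply/imsetP; exists ord0 => //; congr (edge _); apply: idx_edge.
rewrite w0 iE; congr [set _; _].
by rewrite -nth0 /w /= modn_small // ltnS ltnW.
Qed.

(** Membership in the cycle space over the field with two elements: the sum is the parity of the
    degree of [v] in [S]. *)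
Definition even_edge_set (S : pred I) : Prop :=
  forall v, \big[addb/false]_(i | S i) ((v == a i) || (v == b i)) = false.

Lemma loose_cycle_even (C : {set {set ipower m a b}}) :
    C \subset edges (ipower m a b) -> is_loose_cycle C ->
  even_edge_set (fun i => edge i \in C).
Proof.
move=> /subsetP C_sub [l [e [w [l3 [e_inj CE] w_inj w_cap w_disj]]]] v.
have S1 i : ordS i != i :> 'I_l by case/andP: (ordS_neq i l3).
have idx_ex j : exists i, e j = edge i.
  have : e j \in C by rewrite CE imset_f.
  by move/C_sub => /ipower_edgesP [i ->]; exists i.
have [idx idxE] := fin_all_exists idx_ex.
have idx_inj : injective idx.
  by move=> i j ij; apply: e_inj; rewrite !idxE ij.
have w_in j : w j \in e j /\ w (ordS j) \in e j.
  have := set11 (w j); rewrite -w_cap inE => /andP[_ ->].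
  by have := set11 (w (ordS j)); rewrite -w_cap inE ordSK => /andP[->].
(* A new vertex lies in a single edge, whereas [w j] lies in two consecutive, distinct ones. *)
have w_core j : exists v, w j = inl v.
  case wjE: (w j) => [v'|[k n]]; first by exists v'.
  have := set11 (w j); rewrite -w_cap inE !idxE !inE wjE /=.
  case/andP=> /eqP -> /eqP /idx_inj pj; have := S1 (ord_pred j).
  by rewrite ord_predK pj eqxx.
have [c cE] := fin_all_exists w_core.
have windmill_c_inj : injective c by move=> i j ij; apply: w_inj; rewrite !cE ij.
have endE j : (v == a (idx j)) || (v == b (idx j)) = (v == c j) (+) (v == c (ordS j)).
  have [jE SjE] := w_in j; move: jE SjE; rewrite idxE !cE !inE /= => jE SjE.
  have cj_neq : c (ordS j) != c j by rewrite (inj_eq windmill_c_inj).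
  have abE : [set a (idx j); b (idx j)] = [set c j; c (ordS j)].
    move: cj_neq; case/orP: jE => /eqP->; case/orP: SjE => /eqP->; rewrite ?eqxx //.
    by rewrite setUC.
  have /setP /(_ v) := abE; rewrite !inE => ->.
  by have [->|//] := eqVneq v (c j); rewrite eq_sym (negbTE cj_neq).
transitivity (\big[addb/false]_(j < l) ((v == a (idx j)) || (v == b (idx j)))).
  rewrite -(big_imset (fun i => (v == a i) || (v == b i)) (h := idx)) /=; last first.
    by move=> i j _ _; apply: idx_inj.
  apply: eq_bigl => i; rewrite CE; apply/imsetP/imsetP => -[j _].
    by rewrite idxE => /(ipower_edge_inj ab_simple) ->; exists j.
  by move=> ->; exists j.
under eq_bigr do rewrite endE.
(* The second sum is the first one shifted by [ordS], so the two cancel. *)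
rewrite big_split /= [X in _ (+) X](_ : _ = \big[addb/false]_(j < l) (v == c j)).
  exact: addbb.
by rewrite [RHS](reindex (@ordS l)) //=; apply/onW_bij/ordS_bij.
Qed.

End Cycles.

(** * A spanning tree and its two non-tree edges *)

Section Decomposition.
Variables (m : nat) (V I : finType) (a b : I -> V).
Hypothesis ab_simple : simple_ends a b.
Notation ends i := [set a i; b i].
Notation edge := (@ipower_edge m V I a b).

Definition adjacent : rel V := fun v w => [exists i, ends i == [set v; w]].

Lemma adjacent_sym : symmetric adjacent.
Proof. by move=> v w; apply: eq_existsb => i; rewrite (setUC [set v]). Qed.

Lemma ipower_connected_core (u : V) :
  connected_hypergraph (ipower m a b) -> forall v, connect adjacent u v.
Proof.
move=> conn v.
have conn_ab i w : (w == a i) || (w == b i) ->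
    connect adjacent u w = connect adjacent u (a i).
  move=> wi; apply/same_connect_r; first exact/sym_connect_sym/adjacent_sym.
  case/orP: wi => /eqP ->; first exact: connect0.
  by apply/connect1/existsP; exists i; rewrite setUC.
(* A new vertex is given the component of an end of its edge; [Q] is then constant on each edge and
   propagates along walks. *)
pose Q (z : ipower m a b) := match z with
  | inl w => connect adjacent u w
  | inr q => connect adjacent u (a q.1) end.
have QE i z : in_ipower_edge a b i z -> Q z = connect adjacent u (a i).
  by case: z => [w|[k n]] /=; [exact: conn_ab | move/eqP->].
have /connectP [s] := conn (inl u) (inl v).
have : Q (inl u) by exact: connect0.
elim: s (inl u : ipower m a b) => [|y s IH] x Qx /=; first by move: Qx => + _ vE;
  rewrite -vE.
case/andP=> xy ys vE; apply: IH ys vE; move: xy; rewrite coedge_ipower.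
by case/existsP=> i /andP[/QE xi /QE ->]; rewrite -xi.
Qed.

Lemma even_edge_set_addb (S1 S2 : pred I) :
    even_edge_set a b S1 -> even_edge_set a b S2 ->
  even_edge_set a b (fun i => S1 i (+) S2 i).
Proof.
move=> S1_even S2_even v; pose F i := (v == a i) || (v == b i).
transitivity ((\big[addb/false]_(i | S1 i) F i) (+) (\big[addb/false]_(i | S2 i) F i)).
  rewrite big_mkcond [X in _ = X (+) _]big_mkcond [X in _ = _ (+) X]big_mkcond.
  rewrite -big_split; apply: eq_bigr => i _ /=.
  by case: (S1 i); case: (S2 i); rewrite ?addbb ?addbF.
by rewrite S1_even S2_even.
Qed.

Section SpanningTree.
Variables (u : V) (d : V -> nat) (p : V -> V) (t : V -> I).
Hypotheses (d_u : d u = 0%N)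
  (d_p : forall v, v != u -> d v = (d (p v)).+1)
  (d_ends : forall i, (d (a i) <= (d (b i)).+1)%N /\ (d (b i) <= (d (a i)).+1)%N)
  (t_ends : forall v, v != u -> ends (t v) = [set v; p v]).

Definition tree_edge : pred I := fun i => [exists v, (v != u) && (i == t v)].

Lemma tree_edgeP i :
  reflect (exists2 v, v != u & i = t v) (tree_edge i).
Proof.
by apply: (iffP existsP) => [[v /andP[vu /eqP ->]]|[v vu ->]]; exists v; rewrite ?vu /=.
Qed.

Lemma d_adjacent i v w : ends i = [set v; w] -> (d v <= (d w).+1)%N.
Proof.
have [ab ba] := d_ends i.
by case/set2_eqP=> -[<- <-].
Qed.

(** Two vertices sharing a parent edge would be parents of each other, which the depths forbid. *)
Lemma parent_edge_inj : {in [pred v | v != u] &, injective t}.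
Proof.
move=> v w vu wu vw; have := t_ends vu; rewrite vw (t_ends wu).
case/set2_eqP=> -[// wE pE].
have := d_p vu; have := d_p wu; rewrite pE -wE; lia.
Qed.

(* A farthest vertex from [u] whose parent edge is in [S] has degree one in [S]. *)
Lemma even_tree_edges0 (S : pred I) :
  {subset S <= tree_edge} -> even_edge_set a b S -> forall i, ~~ S i.
Proof.
move=> S_tree S_even i; apply/negP => Si; have /tree_edgeP [v0 v0u iE] := S_tree i Si.
have Sv0 : (v0 != u) && S (t v0) by rewrite v0u -iE.
case: (arg_maxnP d (P := fun v => (v != u) && S (t v)) Sv0) => v /andP[vu Sv] v_max.
have := S_even v; rewrite (bigD1 (t v)) //= big1 => [|j /andP[Sj jt]].
  have : v \in ends (t v) by rewrite t_ends // set21.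
  by rewrite !inE => ->.
have /tree_edgeP [w wu jE] := S_tree j Sj.
apply/negP => vj; have : v \in ends j by rewrite !inE.
rewrite jE t_ends // !inE => /orP[/eqP vw|/eqP vp].
  by move: jt; rewrite jE vw eqxx.
have := v_max w; rewrite wu -jE Sj => /(_ isT).
by have := d_p wu; rewrite -vp => -> /=; rewrite ltnn.
Qed.

Definition avoiding_tree (q : pred V) : rel V := fun v w =>
  [exists i, tree_edge i && (ends i == [set v; w])] && (~~ q v && ~~ q w).

Lemma avoiding_tree_sym q : symmetric (avoiding_tree q).
Proof.
move=> v w; rewrite /avoiding_tree (andbC (~~ q v)); congr (_ && _).
by apply: eq_existsb => i; rewrite (setUC [set v]).
Qed.

Lemma avoiding_tree_parent q v : v != u -> ~~ q v -> ~~ q (p v) ->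
  avoiding_tree q v (p v).
Proof.
move=> vu qv qp; rewrite /avoiding_tree qv qp !andbT; apply/existsP; exists (t v).
by rewrite t_ends // eqxx andbT; apply/tree_edgeP; exists v.
Qed.

(** Climb from parent to parent: after the first step the depth is below [n], where no vertex
    satisfies [q]. *)
Lemma connect_tree_le (q : pred V) n v :
    (forall w, q w -> (n <= d w)%N) -> (d v <= n)%N -> ~~ q v ->
  connect (avoiding_tree q) v u.
Proof.
move=> q_far; have [k] := ubnP (d v); elim: k v => // k IH v vk vn qv.
have [->|vu] := eqVneq v u; first exact: connect0.
have dv := d_p vu.
have qp : ~~ q (p v) by apply/negP => /q_far; lia.
apply: connect_trans (connect1 (avoiding_tree_parent vu qv qp)) _.
by apply: IH => //; lia.
Qed.

Lemma tree_path v w (q : pred V) : connect (avoiding_tree q) v u ->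
    connect (avoiding_tree q) w u ->
  exists s, [/\ path (avoiding_tree q) v s, last v s = w & uniq (v :: s)].
Proof.
move=> vu wu; have : connect (avoiding_tree q) v w.
  apply: connect_trans vu _.
  by rewrite (sym_connect_sym (@avoiding_tree_sym q)).
by case/connectP=> s /shortenP [s' s's s'_uniq _] ->; exists s'.
Qed.

Lemma fundamental_cycle g : ~~ tree_edge g ->
  exists C : {set {set ipower m a b}},
    [/\ C \subset edges (ipower m a b), is_loose_cycle C, edge g \in C &
        forall i, edge i \in C -> tree_edge i \/ i = g].
Proof.
move=> gX; have [ab_neq ab_inj] := ab_simple.
have to_u v : connect (avoiding_tree pred0) v u.
  by apply: (@connect_tree_le pred0 (d v)).
have [s [a_s s_b s_uniq]] := tree_path (to_u (a g)) (to_u (b g)).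
have [||||C [C_sub C_cyc gC CP _]] :=
    @path_loose_cycle m V I a b ab_simple tree_edge (a g) s g.
- exact: s_uniq.
- by apply: sub_path a_s => v w /andP[].
(* An empty path would make [g] a loop, and a path of one edge would make [g] a tree edge. *)
- case: s a_s s_b {s_uniq} => [|w [|//]] /=.
    by move=> _ /eqP; rewrite (negbTE (ab_neq g)).
  move=> /andP[/andP[/existsP [i /andP[iT /eqP iE]] _] _] wE.
  by case/negP: gX; have <- : i = g by apply: ab_inj; rewrite iE wE.
- by rewrite s_b.
by exists C.
Qed.

(* Two non-tree edges with a common end [q] close up a tree path avoiding [q]. *)
Lemma third_cycle g1 g2 q q1 q2 :
    ~~ tree_edge g1 -> ~~ tree_edge g2 -> g1 != g2 ->
    ends g1 = [set q; q1] -> ends g2 = [set q; q2] ->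
  exists C : {set {set ipower m a b}},
    [/\ C \subset edges (ipower m a b), is_loose_cycle C, edge g1 \in C &
        edge g2 \in C].
Proof.
move=> g1X g2X g12 g1E g2E; have [ab_neq ab_inj] := ab_simple.
have ends_neq g w : ends g = [set q; w] -> w != q.
  move=> gE; have := ab_neq g.
  by case: (set2_eqP gE) => -[-> ->] //; rewrite eq_sym.
have to_u g w : ~~ tree_edge g -> ends g = [set q; w] ->
    connect (avoiding_tree (pred1 q)) w u.
  move=> gX gE; have wq := ends_neq g w gE.
  have [->|wu] := eqVneq w u; first exact: connect0.
  have q_far v : pred1 q v -> (d q <= d v)%N by move=> /eqP->.
  (* If [w] is no deeper than [q], the climb from [w] misses [q]. Otherwise [w] is exactly one level
     below [q]; its parent is not [q], since [g] would then be the parent edge of [w], and the climb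
     continues from a vertex at the level of [q]. *)
  have [dw|dw] := leqP (d w) (d q); first exact: connect_tree_le q_far dw wq.
  have pq : p w != q.
    apply: contraNneq gX => pq; apply/tree_edgeP; exists w => //.
    by apply: ab_inj; rewrite gE t_ends // pq setUC.
  apply: connect_trans (connect1 (avoiding_tree_parent wu wq pq)) _.
  apply: connect_tree_le q_far _ pq.
  by have := d_adjacent (etrans gE (setUC _ _)); rewrite d_p //; lia.
have [s [q1_s s_q2 s_uniq]] := tree_path (to_u _ _ g1X g1E) (to_u _ _ g2X g2E).
have s_neq : (0 < size s)%N.
  case: s {q1_s s_uniq} s_q2 => //= q12; move: g12; rewrite (ab_inj g1 g2) ?eqxx //.
  by rewrite g1E g2E q12.
have q_notin : q \notin q1 :: s.
  rewrite inE negb_or eq_sym (ends_neq g1) //=.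
  elim: s q1 q1_s {s_q2 s_uniq s_neq g1E} => //= w s IH q1.
  by rewrite inE negb_or eq_sym => /andP[/andP[_ /andP[_ ->]] /IH ->].
(* The cycle leaves [q] by [g1], follows the tree path from [q1] to [q2], and returns by [g2]. *)
have [||||C [C_sub C_cyc gC CP headC]] :=
    @path_loose_cycle m V I a b ab_simple
      (fun i => tree_edge i || (i == g1)) q (q1 :: s) g2.
- by rewrite cons_uniq q_notin.
- rewrite /= ; apply/andP; split.
    by apply/existsP; exists g1; rewrite g1E !eqxx orbT.
  apply: sub_path q1_s => v w /andP[/existsP [i /andP[iT iE]] _].
  by apply/existsP; exists i; rewrite iT.
- by [].
- by rewrite g2E /= s_q2.
by exists C; split=> //; apply: headC; rewrite g1E.
Qed.

End SpanningTree.

(** [tau] lists the edges as parent edges of the vertices other than [u], followed by the two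
    non-tree edges. The final [uniq] is what makes two triangles meeting only at [u] appear once all
    parents are replaced by [u]. *)
Theorem bicyclic_decomposition (u : V) :
    connected_hypergraph (ipower m a b) -> bicyclic (ipower m a b) ->
  exists (p : V -> V) (g : bool -> I) (tau : {v | v != u} + bool -> I),
    [/\ bijective tau, forall k, tau (inr k) = g k,
        forall v, ends (tau (inl v)) = [set val v; p (val v)] &
        uniq [:: u; a (g false); b (g false); a (g true); b (g true)]].
Proof.
move=> conn [C1 [C2 [C12 C_all]]]; have [ab_neq ab_inj] := ab_simple.
have C_or (C : {set {set ipower m a b}}) : C \subset edges (ipower m a b) ->
  is_loose_cycle C -> C = C1 \/ C = C2.
  by move=> ? ?; apply/C_all.
have [C1_sub C1_cyc] := (C_all C1).2 (or_introl erefl).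
have [C2_sub C2_cyc] := (C_all C2).2 (or_intror erefl).
have C_edge (C : {set {set ipower m a b}}) : C \subset edges (ipower m a b) ->
    is_loose_cycle C -> exists i, edge i \in C.
  move=> /subsetP C_sub [l [e [w [l3 [_ CE] _ _ _]]]].
  have eC : e (Ordinal (ltnW (ltnW l3))) \in C by rewrite CE imset_f.
  by have /ipower_edgesP [i ei] := C_sub _ eC; exists i; rewrite -ei.
have [d [p [d_u dp d_adj]]] := bfs_tree adjacent_sym (ipower_connected_core u conn).
have t_ex v : exists i, v != u -> ends i = [set v; p v].
  have [->|vu] := eqVneq v u.
    by have [i _] := C_edge _ C1_sub C1_cyc; exists i.
  by have [/existsP [i /eqP iE] _] := dp v vu; exists i.
have [t t_ends] := fin_all_exists t_ex.
have d_p v : v != u -> d v = (d (p v)).+1 by move=> /dp [].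
have d_ends i : (d (a i) <= (d (b i)).+1)%N /\ (d (b i) <= (d (a i)).+1)%N.
  by split; apply: d_adj; apply/existsP; exists i; rewrite // setUC.
pose T := tree_edge u t.
have C_nontree (C : {set {set ipower m a b}}) : C \subset edges (ipower m a b) ->
    is_loose_cycle C -> exists2 i, edge i \in C & ~~ T i.
  move=> C_sub C_cyc; have [i iC] := C_edge C C_sub C_cyc.
  case: (pickP (fun i => (edge i \in C) && ~~ T i)) => [j /andP[jC jT]|none].
    by exists j.
  have S_tree : {subset (fun i => edge i \in C) <= T}.
    by move=> j jC; have := none j; rewrite [edge j \in C]jC /= => /negbFE.
  have /(_ i) := even_tree_edges0 d_p t_ends S_tree (loose_cycle_even ab_simple C_sub
    C_cyc).
  by rewrite iC.
have [g1 g1C g1X] := C_nontree C1 C1_sub C1_cyc.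
have [g2 g2X g21] : exists2 g2, ~~ T g2 & g2 != g1.
  case: (pickP (fun i => ~~ T i && (i != g1))) => [j /andP[jT jg]|none];
    first by exists j.
  have X_g1 i : ~~ T i -> i = g1.
    by move=> iX; apply/eqP; have := none i; rewrite iX /= => /negbFE.
  have g1C2 : edge g1 \in C2.
    by have [i iC /X_g1 <-] := C_nontree C2 C2_sub C2_cyc.
  (* If [g1] were the only non-tree edge, it would lie in both cycles, so their symmetric difference
     would be an even set of tree edges, hence empty. *)
  pose S i := (edge i \in C1) (+) (edge i \in C2).
  have S_tree : {subset S <= T}.
    move=> i; apply: contraLR => /X_g1 ->.
    by rewrite unfold_in /S g1C g1C2.
  have S_even : even_edge_set a b S.
    apply: even_edge_set_addb; exact: loose_cycle_even.
  have S0 := even_tree_edges0 d_p t_ends S_tree S_even.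
  case/eqP: C12; apply/setP => e; apply/idP/idP => eC.
    have /ipower_edgesP [i eE] := subsetP C1_sub e eC.
    by have := S0 i; rewrite /S -eE eC => /negPn.
  have /ipower_edgesP [i eE] := subsetP C2_sub e eC.
  by have := S0 i; rewrite /S -eE eC addbT => /negPn.
have fund g := fundamental_cycle d_u d_p t_ends (g := g).
have neqC (C D : {set {set ipower m a b}}) i : edge i \in C -> edge i \notin D ->
  C <> D.
  by move=> iC iD CD; rewrite -CD iC in iD.
have X_cases g : ~~ T g -> g = g1 \/ g = g2.
  move=> gX; have [->|gg1] := eqVneq g g1; first by left.
  have [->|gg2] := eqVneq g g2; first by right.
  (* Three non-tree edges would have three distinct fundamental cycles, each containing just one of
     them. *)
  have [F1 [/C_or F1_sub /F1_sub F1_or g1F1 F1P]] := fund g1 g1X.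
  have [F2 [/C_or F2_sub /F2_sub F2_or g2F2 F2P]] := fund g2 g2X.
  have [F [/C_or F_sub /F_sub F_or gF FP]] := fund g gX.
  have out1 i : ~~ T i -> i != g1 -> edge i \notin F1.
    by move=> iX ig; apply/negP => /F1P [iT|/eqP]; [case/negP: iX|apply/negP].
  have out2 i : ~~ T i -> i != g2 -> edge i \notin F2.
    by move=> iX ig; apply/negP => /F2P [iT|/eqP]; [case/negP: iX|apply/negP].
  have := neqC F F1 g gF (out1 g gX gg1).
  have := neqC F F2 g gF (out2 g gX gg2).
  have := neqC F2 F1 g2 g2F2 (out1 g2 g2X g21).
  by case: F_or => ->; case: F1_or => ->; case: F2_or => ->.
have disjoint_ends q q1 q2 : ends g1 = [set q; q1] -> ends g2 = [set q; q2] -> False.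
  move=> g1E g2E; rewrite eq_sym in g21.
  have [F1 [/C_or F1_sub /F1_sub F1_or g1F1 F1P]] := fund g1 g1X.
  have [F2 [/C_or F2_sub /F2_sub F2_or g2F2 F2P]] := fund g2 g2X.
  (* [F] contains both non-tree edges, while each fundamental cycle contains only its own. *)
  have [F [/C_or F_sub /F_sub F_or g1F g2F]] :=
    third_cycle d_u d_p d_ends t_ends g1X g2X g21 g1E g2E.
  have g2F1 : edge g2 \notin F1.
    by apply/negP => /F1P [iT|/eqP]; [case/negP: g2X | rewrite eq_sym; apply/negP].
  have g1F2 : edge g1 \notin F2.
    by apply/negP => /F2P [iT|/eqP]; [case/negP: g1X | apply/negP].
  have := neqC F F1 g2 g2F g2F1.
  have := neqC F F2 g1 g1F g1F2.
  have := neqC F2 F1 g2 g2F2 g2F1.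
  by case: F_or => ->; case: F1_or => ->; case: F2_or => ->.
have u_notin g w : ~~ T g -> ends g = [set u; w] -> False.
  move=> gX gE; have wu : w != u.
    by have := ab_neq g; case: (set2_eqP gE) => -[-> ->]; rewrite // eq_sym.
  (* A neighbor of [u] has depth at most one, so its parent is [u] and the edge is its parent
     edge. *)
  have pwu : p w = u.
    apply/eqP/negPn/negP => /d_p; have := d_p w wu.
    by have := d_adjacent d_ends (etrans gE (setUC _ _)); lia.
  case/negP: gX; apply/tree_edgeP; exists w => //.
  by apply: ab_inj; rewrite gE t_ends // pwu setUC.
pose g (k : bool) := if k then g2 else g1.
pose tau (z : {v | v != u} + bool) := match z with inl v => t (val v) | inr k =>
  g k end.
have T_t v : v != u -> T (t v) by move=> vu; apply/tree_edgeP; exists v.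
have gX k : ~~ T (g k) by case: k.
exists p, g, tau; split=> //.
- have tau_sur i : exists z, tau z = i.
    have [/tree_edgeP [v vu ->]|/X_cases [] ->] := boolP (T i).
    + by exists (inl (Sub v vu)).
    + by exists (inr false).
    by exists (inr true).
  have [s sK] := fin_all_exists tau_sur; exists s => //.
  apply: inj_can_sym sK _ => -[v|k] [w|k'] /= eq_tau.
  + by congr inl; apply: val_inj;
    exact: (parent_edge_inj d_u d_p t_ends (valP v) (valP w) eq_tau).
  + by have := gX k'; rewrite -eq_tau T_t // (valP v).
  + by have := gX k; rewrite eq_tau T_t // (valP w).
  by move: g21; case: k eq_tau; case: k' => //= ->; rewrite eqxx.
- by move=> v; rewrite /= t_ends // (valP v).
have u_a i : ~~ T i -> u != a i by move=> iX; apply/eqP => uE;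
  apply: (u_notin i (b i)); rewrite ?uE.
have u_b i : ~~ T i -> u != b i.
  by move=> iX; apply/eqP => uE; apply: (u_notin i (a i)); rewrite ?uE 1?setUC.
have ends_neq v w : v \in ends g1 -> w \in ends g2 -> v != w.
  have ends_set i x : x \in ends i -> exists y, ends i = [set x; y].
    rewrite !inE => /orP[]/eqP ->; first by exists (b i).
    by exists (a i); rewrite setUC.
  move=> /ends_set [y1 g1E] /ends_set [y2 g2E]; apply/eqP => vw.
  by apply: (disjoint_ends w y1 y2); rewrite // -vw.
by rewrite /= !inE !negb_or !ab_neq !u_a ?u_b ?ends_neq ?inE ?eqxx ?orbT.
Qed.
End Decomposition.

(** * The extremal hypergraph *)

Section Windmill.
Variables (m : nat) (V : finType) (u : V) (c d : bool -> V).
Hypothesis m_ge2 : (2 <= m)%N.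
Let core_seq := [:: u; c false; d false; c true; d true].
Hypothesis core_uniq : uniq core_seq.

Definition spoke := {v | v != u}.

(** The graph is the star centred at [u] with two disjoint chords [c k], [d k] between leaves. The
    first end of a spoke is its own vertex, the second its parent. *)
Definition windmill_a (z : spoke + bool) : V :=
  match z with inl v => val v | inr k => c k end.
Definition windmill_b (z : spoke + bool) : V :=
  match z with inl v => u | inr k => d k end.

Definition windmill : hypergraph := ipower m windmill_a windmill_b.

Let l := #|[pred v | v \notin core_seq]|.

Lemma windmill_c_neq k : c k != u.
Proof.
move: core_uniq; rewrite /= !inE !negb_or.
by case: k => /andP[/and4P[uc1 ud1 uc2 ud2] _]; rewrite eq_sym.
Qed.

Lemma windmill_d_neq k : d k != u.
Proof.
move: core_uniq; rewrite /= !inE !negb_or.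
by case: k => /andP[/and4P[uc1 ud1 uc2 ud2] _]; rewrite eq_sym.
Qed.

Definition c_spoke k : spoke := Sub (c k) (windmill_c_neq k).
Definition d_spoke k : spoke := Sub (d k) (windmill_d_neq k).

Lemma pendant_neq (i : 'I_l) : enum_val i != u.
Proof. by have := enum_valP i; rewrite !inE negb_or => /andP[]. Qed.

Definition pendant_spoke (i : 'I_l) : spoke := Sub (enum_val i) (pendant_neq i).

Definition triangle_core (k : bool) (i : 'I_3) : V :=
  match val i with 0 => u | 1 => c k | _ => d k end.

Definition triangle_edge (k : bool) (i : 'I_3) : spoke + bool :=
  match val i with 0 => inl (c_spoke k) | 1 => inr k | _ => inl (d_spoke k) end.

Definition triangle_map (k : bool) (z : loose_cycle m 3) : windmill :=
  match z with
  | inl i => inl (triangle_core k i)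
  | inr q => inr (triangle_edge k q.1, q.2)
  end.

Fact pendant_size : (m - 1 = (m - 2).+1)%N. Proof. lia. Qed.

(** In [BC] the [m - 1] vertices added by a pendant edge play equal roles, while in a power one of
    them is the leaf of the graph. Index [0] is sent to the leaf and the others to the new
    vertices. *)
Definition pendant_map (i : 'I_l) (j : 'I_(m - 1)) : windmill :=
  if unlift ord0 (cast_ord pendant_size j) is Some j'
  then inr (inl (pendant_spoke i), j') else inl (enum_val i).

Definition BC_map (z : BC m l) : windmill :=
  match z with
  | inl (inl y) => triangle_map false y
  | inl (inr y) => triangle_map true (val y)
  | inr q => pendant_map q.1 q.2
  end.

Lemma triangle_map_edge k i :
  triangle_map k @: cycle_edge m i = ipower_edge m windmill_a windmill_b
    (triangle_edge k i).
Proof.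
apply/setP => z; apply/imsetP/idP => [[y yi ->]|].
  move: yi; rewrite !inE => /or3P[/eqP->|/eqP->|/imsetP [j _ ->]] /=; last exact: eqxx.
    by case: i => [[|[|[|]]]] //= ?; rewrite eqxx ?orbT.
  by case: i => [[|[|[|]]]] //= ?; rewrite eqxx ?orbT.
rewrite inE; case: z => [v|[e j]] /=.
  move=> vi.
  have : (v == triangle_core k i) || (v == triangle_core k (ordS i)).
    by case: i vi => [[|[|[|]]]] //= ?; rewrite ?orbF // orbC.
  case/orP=> /eqP->; first by exists (inl i); rewrite // !inE eqxx.
  by exists (inl (ordS i)); rewrite // !inE eqxx orbT.
move/eqP->; exists (inr (i, j)) => //; rewrite !inE; apply/orP; right.
by apply/imsetP; exists j.
Qed.

Lemma pendant_map_edge (i : 'I_l) :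
  BC_map @: @pendant_edge m (coalescence (core0 m) (core0 m)) (inl (core0 m)) l i =
  ipower_edge m windmill_a windmill_b (inl (pendant_spoke i)).
Proof.
apply/setP => z; apply/imsetP/idP => [[y yi ->]|].
  move: yi; rewrite !inE => /orP[/eqP->|/imsetP [j _ ->]] /=.
    by rewrite eqxx orbT.
  by rewrite /pendant_map; case: unlift => [j'|] /=; rewrite eqxx.
rewrite inE; case: z => [v|[e j]] /=.
  case/orP=> /eqP->; last by exists (inl (inl (core0 m))); rewrite // !inE eqxx.
  exists (inr (i, cast_ord (esym pendant_size) ord0)).
    by rewrite !inE; apply/orP; right; apply/imsetP; eexists.
  by rewrite /= /pendant_map cast_ordKV unlift_none.
move/eqP->; exists (inr (i, cast_ord (esym pendant_size) (lift ord0 j))).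
  by rewrite !inE; apply/orP; right; apply/imsetP; eexists.
by rewrite /= /pendant_map cast_ordKV liftK.
Qed.

Lemma BC_map_coalescence_inr y :
  BC_map (inl (coalescence_inr (core0 m) (core0 m) y)) = triangle_map true y.
Proof.
rewrite /coalescence_inr; case: insubP => [z _ <- //|].
by rewrite negbK => /eqP ->.
Qed.

Lemma BC_map_edges (e : {set BC m l}) : e \in edges (BC m l) ->
  BC_map @: e \in edges windmill.
Proof.
rewrite !inE => /orP[/imsetP [e1]|/imsetP [i _ ->]]; last first.
  by rewrite pendant_map_edge; apply/ipower_edgesP; eexists.
rewrite inE => /orP[/imsetP [e2]|/imsetP [e2]] /imsetP [i _ ->] -> ->;
  rewrite -!imset_comp; apply/ipower_edgesP.
  by exists (triangle_edge false i); rewrite -triangle_map_edge.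
exists (triangle_edge true i); rewrite -triangle_map_edge; apply: eq_imset => y /=.
exact: BC_map_coalescence_inr.
Qed.

Lemma windmill_edge_BC i :
  exists2 e, e \in edges (BC m l) & BC_map @: e = ipower_edge m windmill_a windmill_b i.
Proof.
have tri k j : exists2 e, e \in edges (BC m l) &
    BC_map @: e = ipower_edge m windmill_a windmill_b (triangle_edge k j).
  exists (inl @: ((if k then coalescence_inr (core0 m) (core0 m) else inl) @:
    cycle_edge m j)).
    rewrite !inE; apply/orP; left; apply/imsetP; eexists; last reflexivity.
    rewrite inE; apply/orP; case: k; [right|left]; apply/imsetP;
      by exists (cycle_edge m j) => //; apply: imset_f.
  rewrite -triangle_map_edge -!imset_comp; apply: eq_imset; case: k => y //=.
  exact: BC_map_coalescence_inr.
case: i => [v|k]; last by have := tri k (Ordinal (isT : 1 < 3)).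
have v_neq := valP v.
have [v_core|v_pend] := boolP (val v \in core_seq); last first.
  have vl : val v \in [pred v | v \notin core_seq] by [].
  exists (@pendant_edge m (coalescence (core0 m) (core0 m)) (inl (core0 m)) l
    (enum_rank_in vl (val v))).
    by rewrite inE; apply/orP; right; apply: imset_f.
  rewrite pendant_map_edge; congr (ipower_edge _ _ _ (inl _)); apply: val_inj => /=.
  by rewrite enum_rankK_in.
have tri_c k : val v = c k -> exists2 e, e \in edges (BC m l) &
    BC_map @: e = ipower_edge m windmill_a windmill_b (inl v).
  move=> vc; have := tri k ord0; rewrite /triangle_edge /=.
  by have -> : c_spoke k = v by apply: val_inj.
have tri_d k : val v = d k -> exists2 e, e \in edges (BC m l) &
    BC_map @: e = ipower_edge m windmill_a windmill_b (inl v).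
  move=> vd; have := tri k (Ordinal (isT : 2 < 3)); rewrite /triangle_edge /=.
  by have -> : d_spoke k = v by apply: val_inj.
move: v_core; rewrite !inE (negbTE v_neq) /=.
by case/or4P=> /eqP; [exact: tri_c | exact: tri_d | exact: tri_c | exact: tri_d].
Qed.

Lemma card_pred_neq (T : finType) (x : T) : #|[pred y | y != x]| = #|T|.-1.
Proof. by rewrite -(cardC1 x); apply: eq_card. Qed.

Lemma card_windmill_vertex : #|V| = (5 + l)%N.
Proof.
rewrite -(cardC [pred v | v \in core_seq]); congr (_ + _)%N.
by have /card_uniqP := core_uniq; rewrite -[RHS]/5%N => <-; apply: eq_card.
Qed.

Lemma card_spoke : #|{: spoke}| = (l + 4)%N.
Proof. by rewrite card_sig card_pred_neq card_windmill_vertex [RHS]addnC. Qed.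

Lemma card_BC : #|BC m l| = #|windmill|.
Proof.
rewrite !(card_sum, card_prod, card_ord, card_spoke, card_sig, card_bool).
rewrite card_pred_neq !(card_sum, card_prod, card_ord) card_windmill_vertex.
move: (l) => n.
case: m m_ge2 => [|[|m']] // _.
by rewrite !subSS !subn0; nia.
Qed.

(** [BC_map] is onto because every edge of the windmill is the image of an edge; equality of the
    vertex counts then gives bijectivity without a case analysis for injectivity. *)
Theorem BC_iso_windmill : hypergraph_iso (BC m l) windmill.
Proof.
have f_sur z : exists y, BC_map y = z.
  have [i zi] : exists i, z \in ipower_edge m windmill_a windmill_b i.
    case: z => [v|[i j]]; last by exists i; rewrite inE /= eqxx.
    have [->|vu] := eqVneq v u.
      by exists (inl (c_spoke true)); rewrite inE /= eqxx orbT.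
    by exists (inl (Sub v vu)); rewrite inE /= eqxx.
  have [e _ eE] := windmill_edge_BC i.
  by move: zi; rewrite -eE => /imsetP [y _ ->]; exists y.
have [g fK] := fin_all_exists f_sur.
have f_bij : bijective BC_map.
  by apply: (bij_can_bij _ fK); apply: inj_card_bij (can_inj fK) _; rewrite card_BC.
exists BC_map => // e; apply/idP/idP; last exact: BC_map_edges.
move/ipower_edgesP=> [i eE]; have [e' e'E e'i] := windmill_edge_BC i.
by rewrite (imset_inj (bij_inj f_bij) (etrans eE (esym e'i))).
Qed.

End Windmill.

Local Open Scope ring_scope.

(** * Spectral radius of a hypergraph *)

Section SpectralNorm.
Variable C : numClosedFieldType.
Local Open Scope sesquilinear_scope.

Lemma sqr_norm_mx n (v : 'rV[C]_n) :
  (v *m v ^t*) 0 0 = \sum_i `|v 0 i| ^+ 2.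
Proof. by rewrite mxE; apply: eq_bigr => i _; rewrite !mxE normCK. Qed.

Lemma sqr_norm_unitary n (P : 'M[C]_n) (v : 'rV[C]_n) : P \is unitarymx ->
  \sum_i `|(v *m P) 0 i| ^+ 2 = \sum_i `|v 0 i| ^+ 2.
Proof.
move=> uP; rewrite -!sqr_norm_mx trmx_mul map_mxM /= mulmxA.
by rewrite -(mulmxA v P) (unitarymxP uP) mulmx1.
Qed.

(** In a unitary eigenbasis, which preserves norms, [A] scales each coordinate by an eigenvalue. *)
Lemma hermitian_norm_le n (A : 'M[C]_n) (r : C) (v : 'rV[C]_n) :
    A \is hermsymmx -> (forall z, eigenvalue A z -> `|z| <= r) ->
  \sum_i `|(v *m A) 0 i| ^+ 2 <= r ^+ 2 * \sum_i `|v 0 i| ^+ 2.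
Proof.
move=> hA hr; set P := spectralmx A; set D := spectral_diag A.
have uP : P \is unitarymx by exact: spectral_unitarymx.
have Pu : P \in unitmx by exact: spectral_unit.
have AE : A = invmx P *m diag_mx D *m P.
  by have /orthomx_spectralP := hermitian_normalmx hA.
have Dr i : `|D 0 i| <= r.
  apply/hr/eigenvalueP; exists (row i P).
    rewrite -row_mul [in LHS]AE !mulmxA mulmxV // mul1mx.
    by rewrite mul_diag_mx; apply/rowP => j; rewrite !mxE.
  apply/negP => /eqP Pi0; have := unitarymxP uP => /matrixP /(_ i i).
  rewrite !mxE eqxx big1 => [/eqP|j _]; first by rewrite eq_sym oner_eq0.
  by have /rowP /(_ j) := Pi0; rewrite !mxE => ->; rewrite mul0r.
rewrite AE !mulmxA sqr_norm_unitary // -(@sqr_norm_unitary _ (invmx P) v).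
  rewrite mulr_sumr; apply: ler_sum => i _.
  rewrite mul_mx_diag mxE normrM exprMn mulrC ler_wpM2r ?exprn_ge0 //.
  by rewrite lerXn2r ?nnegrE // (le_trans _ (Dr i)).
by rewrite invmx_unitary // trmxC_unitary.
Qed.

End SpectralNorm.

Lemma coedge_iso (H1 H2 : hypergraph) (f : H1 -> H2) : injective f ->
    (forall e : {set H1}, (f @: e \in edges H2) = (e \in edges H1)) ->
    (forall y, exists x, y = f x) ->
  forall v w, coedge H2 (f v) (f w) = coedge H1 v w.
Proof.
move=> f_inj fE f_sur v w; apply/existsP/existsP => [[e]|[e]] /and3P[eH ve we].
  have eE : e = f @: (f @^-1: e).
    apply/setP => y; have [x ->] := f_sur y.
    by rewrite mem_imset // inE.
  by exists (f @^-1: e); rewrite -fE -eE eH !inE ve.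
by exists (f @: e); rewrite fE eH !mem_imset // ve we.
Qed.

Lemma hypergraph_iso_sym H1 H2 : hypergraph_iso H1 H2 -> hypergraph_iso H2 H1.
Proof.
case=> f [g fK gK] fE; exists g => [|e]; first by exists f.
by rewrite -fE -imset_comp (eq_imset (g := id)) ?imset_id.
Qed.

Lemma hypergraph_iso_trans H1 H2 H3 :
  hypergraph_iso H1 H2 -> hypergraph_iso H2 H3 -> hypergraph_iso H1 H3.
Proof.
move=> [f f_bij fE] [g g_bij gE]; exists (g \o f) => [|e].
  exact: bij_comp.
by rewrite imset_comp gE fE.
Qed.

(** * Perron vectors and Rayleigh quotients *)

Section Adjacency.
Variable C : numClosedFieldType.

Definition neighbor_sum (H : hypergraph) (x : H -> C) (v : H) : C :=
  \sum_(w | (v != w) && coedge H v w) x w.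

Lemma coedge_sym (H : hypergraph) : symmetric (coedge H).
Proof. by move=> x y; apply: eq_existsb => e; rewrite (andbC (x \in e)). Qed.

Lemma sum_enum_val (T : finType) (F : T -> C) :
  \sum_v F v = \sum_(i < #|T|) F (enum_val i).
Proof. by rewrite -(big_enum_val (A := T)); apply: eq_bigl. Qed.

Lemma sum_sqr_norm_le0 (T : finType) (F : T -> C) :
  \sum_v `|F v| ^+ 2 <= 0 -> forall v, F v = 0.
Proof.
have F_ge0 v : true -> 0 <= `|F v| ^+ 2 by rewrite exprn_ge0.
move=> le0 v; have : \sum_v `|F v| ^+ 2 = 0.
  by apply/le_anti; rewrite le0 sumr_ge0.
move=> /eqP; rewrite psumr_eq0 // => /allP /(_ v (mem_index_enum v)).
by rewrite sqrf_eq0 normr_eq0 => /eqP.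
Qed.

(** The spectral radius of the 0-1 adjacency matrix, free of the factor [1 / (m - 1)]; the roots of
    the quintic live on this scale. *)
Definition scaled_radius (m : nat) (H : hypergraph) : C :=
  (m%:R - 1) * lambda1 C m H.

Variables (m : nat) (m_ge2 : (2 <= m)%N).

Let m1_gt0 : 0 < m%:R - 1 :> C.
Proof. by rewrite subr_gt0 ltr1n. Qed.

Section OneHypergraph.
Variables (H : hypergraph) (v0 : H).

Let row_of (x : H -> C) : 'rV[C]_#|H| := \row_i x (enum_val i).

Let H_gt0 : (0 < #|H|)%N.
Proof. by apply/card_gt0P; exists v0. Qed.

Lemma row_adjacencyE (x : H -> C) i :
  (row_of x *m adjacency C m H) 0 i = (m%:R - 1)^-1 * neighbor_sum x (enum_val i).
Proof.
rewrite mxE mulr_sumr [in RHS]big_mkcond /= [RHS](@sum_enum_val H); apply: eq_bigr =>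
  j _.
rewrite !mxE eq_sym coedge_sym (inj_eq enum_val_inj).
by case: ifP; rewrite ?inE ?mulr0 // mulrC.
Qed.

Lemma eigenvalue_adjacencyP z :
  reflect (exists2 x : H -> C, exists v, x v != 0 &
             forall v, neighbor_sum x v = (m%:R - 1) * z * x v)
          (eigenvalue (adjacency C m H) z).
Proof.
apply: (iffP eigenvalueP) => [[u uA u0]|[x [v xv0] xE]].
  pose x v := u 0 (enum_rank v).
  have ux : u = row_of x by apply/rowP => i; rewrite mxE /x enum_valK.
  exists x => [|v].
    by have /rV0Pn [i ui] := u0; exists (enum_val i); rewrite /x enum_valK.
  have /rowP /(_ (enum_rank v)) := uA.
  rewrite ux row_adjacencyE !mxE enum_rankK /= => /(canRL (mulKf _)) ->.
    by rewrite invrK mulrA.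
  by rewrite invr_neq0 // gt_eqF.
exists (row_of x).
  apply/rowP => i; rewrite row_adjacencyE !mxE xE -mulrA mulKf //.
  by rewrite gt_eqF.
by apply/rV0Pn; exists (enum_rank v); rewrite mxE enum_rankK.
Qed.

Lemma lambda1_ge0 : 0 <= lambda1 C m H.
Proof.
have [[z _ zE] _] := spectral_radiusP (adjacency C m H) H_gt0.
by rewrite /lambda1 -zE normr_ge0.
Qed.

Lemma scaled_radius_ge0 : 0 <= scaled_radius m H.
Proof. by rewrite mulr_ge0 ?lambda1_ge0 // ltW. Qed.

Lemma eigen_le_scaled_radius z (x : H -> C) :
    (exists v, x v != 0) -> (forall v, neighbor_sum x v = z * x v) ->
  `|z| <= scaled_radius m H.
Proof.
move=> x0 xE; have [_ le_r] := spectral_radiusP (adjacency C m H) H_gt0.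
move: (le_r (z / (m%:R - 1))).
rewrite normrM normfV (gtr0_norm m1_gt0) ler_pdivrMr // (mulrC (spectral_radius _));
  apply.
apply/eigenvalue_adjacencyP; exists x => // v.
by rewrite xE mulrCA divff ?mulr1 // gt_eqF.
Qed.

Lemma neighbor_sum_norm_le (x : H -> C) :
  \sum_v `|neighbor_sum x v| ^+ 2 <=
    scaled_radius m H ^+ 2 * \sum_v `|x v| ^+ 2.
Proof.
have hA : adjacency C m H \is hermsymmx.
  apply: realsym_hermsym.
    apply/is_hermitianmxP; rewrite expr0 scale1r map_mx_id //.
    by apply/matrixP => i j; rewrite !mxE eq_sym coedge_sym.
  apply/mxOverP => i j; rewrite mxE; case: ifP => // _.
  by rewrite rpredV; apply: ger0_real; rewrite ltW.
have [_ hr] := spectral_radiusP (adjacency C m H) H_gt0.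
have := hermitian_norm_le (row_of x) hA hr.
under eq_bigr do
  rewrite row_adjacencyE normrM exprMn normfV (gtr0_norm m1_gt0) exprVn.
under [X in _ * X]eq_bigr do rewrite mxE.
rewrite -mulr_sumr -!(sum_enum_val (fun v => `|_ v| ^+ 2)).
by rewrite ler_pdivrMl ?exprn_gt0 // mulrA -exprMn.
Qed.

Lemma neighbor_sum_ge0 (x : H -> C) v :
  (forall w, 0 <= x w) -> 0 <= neighbor_sum x v.
Proof. by move=> x_ge0; apply: sumr_ge0 => w _; apply: x_ge0. Qed.

(** Expand the square and bound the norm of [neighbor_sum x] by [neighbor_sum_norm_le]. Since the
    left side is nonnegative, this one estimate yields both the Rayleigh inequality and its equality
    case. *)
Lemma sum_sqr_residual (x : H -> C) : (forall v, 0 <= x v) ->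
  \sum_v `|scaled_radius m H * x v - neighbor_sum x v| ^+ 2 <=
    2 * scaled_radius m H * (scaled_radius m H * (\sum_v x v ^+ 2)
                             - \sum_v x v * neighbor_sum x v).
Proof.
move=> x_ge0; set r := scaled_radius m H; pose y := neighbor_sum x.
have y_ge0 v : 0 <= y v by apply: neighbor_sum_ge0.
have r_ge0 : 0 <= r by exact: scaled_radius_ge0.
have sqE (z : H -> C) : (forall v, 0 <= z v) ->
  \sum_v `|z v| ^+ 2 = \sum_v z v ^+ 2.
  by move=> z_ge0; apply: eq_bigr => v _; rewrite ger0_norm.
have := neighbor_sum_norm_le x; rewrite -/r (sqE x) // (sqE y) // -subr_ge0.
rewrite -[in X in X -> _](lerD2l (\sum_v `|r * x v - y v| ^+ 2)) addr0.
move=> /le_trans; apply; rewrite le_eqVlt; apply/orP; left; apply/eqP.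
rewrite !mulr_sumr -!sumrB -!big_split /= mulr_sumr; apply: eq_bigr => v _.
have res_real : r * x v - y v \is Num.real.
  by apply: rpredB; apply: ger0_real => //; apply: mulr_ge0.
by rewrite real_normK // -/(y v); ring.
Qed.

Lemma rayleigh_le (x : H -> C) : (forall v, 0 <= x v) ->
  \sum_v x v * neighbor_sum x v <= scaled_radius m H * (\sum_v x v ^+ 2).
Proof.
move=> x_ge0; have := sum_sqr_residual x_ge0.
have := scaled_radius_ge0; set r := scaled_radius m H.
(* At radius zero the factor [2 * r] cannot be cancelled, but the residual bound itself makes every
   neighbor sum vanish. *)
rewrite le_eqVlt => /predU1P[<- le_res|r_gt0 le_res].
  rewrite big1 ?mul0r // => v _; move: le_res; rewrite mulr0 mul0r.
  by move=> /sum_sqr_norm_le0 /(_ v); rewrite mul0r sub0r => /eqP;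
    rewrite oppr_eq0 => /eqP->; rewrite mulr0.
rewrite -subr_ge0 -(pmulr_rge0 _ (mulr_gt0 (ltr0n C 2) r_gt0)).
by apply: le_trans le_res; apply: sumr_ge0 => v _; rewrite exprn_ge0.
Qed.

Lemma rayleigh_eq (x : H -> C) : (forall v, 0 <= x v) ->
    \sum_v x v * neighbor_sum x v = scaled_radius m H * (\sum_v x v ^+ 2) ->
  forall v, neighbor_sum x v = scaled_radius m H * x v.
Proof.
move=> x_ge0 eq_x v; have := sum_sqr_residual x_ge0.
rewrite eq_x subrr mulr0 => /sum_sqr_norm_le0 /(_ v) /eqP.
by rewrite subr_eq0 => /eqP.
Qed.

(* The moduli of the entries of an eigenvector of maximal modulus form a
   subsolution, which the norm bound forces to be an eigenvector. *)
Lemma nonneg_eigenvector : exists2 x : H -> C,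
  (forall v, 0 <= x v) /\ (exists v, 0 < x v) &
  forall v, neighbor_sum x v = scaled_radius m H * x v.
Proof.
have [[z /eigenvalue_adjacencyP [w [v1 w0] wE] zE] _] :=
  spectral_radiusP (adjacency C m H) H_gt0.
set r := scaled_radius m H; pose x v := `|w v|; pose y := neighbor_sum x.
have x_ge0 v : 0 <= x v by exact: normr_ge0.
have y_ge0 v : 0 <= y v by exact: neighbor_sum_ge0.
have r_ge0 : 0 <= r by exact: scaled_radius_ge0.
have le_rxy v : r * x v <= y v.
  rewrite /r /scaled_radius /lambda1 -zE -[m%:R - 1](gtr0_norm m1_gt0).
  by rewrite -!normrM -wE; apply: ler_norm_sum.
have rx_ge0 v : 0 <= r * x v by exact: mulr_ge0.
have sq_ge0 v : 0 <= y v ^+ 2 - (r * x v) ^+ 2.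
  by rewrite subr_ge0 lerXn2r ?nnegrE.
exists x => [|v]; first by split=> //; exists v1; rewrite normr_gt0.
have : \sum_v (y v ^+ 2 - (r * x v) ^+ 2) <= 0.
  rewrite sumrB subr_le0; have := neighbor_sum_norm_le x.
  rewrite mulr_sumr -/y (eq_bigr (fun u => y u ^+ 2)) => [|u _]; last first.
    by rewrite ger0_norm.
  rewrite [X in _ <= X](eq_bigr (fun u => (r * x u) ^+ 2)) // => u _.
  by rewrite [RHS]exprMn ger0_norm.
move=> le0; have /eqP : \sum_u (y u ^+ 2 - (r * x u) ^+ 2) = 0.
  by apply/le_anti; rewrite le0; apply: sumr_ge0.
rewrite psumr_eq0 //.
move=> /allP /(_ v (mem_index_enum v)); rewrite subr_eq0.
by rewrite eqrXn2 // => /eqP.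
Qed.

Lemma perron_eigenvector : connected_hypergraph H ->
  exists2 x : H -> C, forall v, 0 < x v &
    forall v, neighbor_sum x v = scaled_radius m H * x v.
Proof.
move=> H_conn; have [x [x_ge0 [v1 x_gt0]] xE] := nonneg_eigenvector.
exists x => // v; have /connectP [p] := H_conn v1 v.
elim: p v1 x_gt0 => [v1 x_gt0 _ -> //|w p IH] v1 x_gt0 /= /andP[v1w pw] vE.
apply: IH pw vE; have [<- //|v1'w] := eqVneq v1 w.
(* A zero entry at [w] makes the neighbor sum there zero, hence the entry at its neighbor [v1]
   too. *)
rewrite lt_neqAle x_ge0 andbT eq_sym; apply: contraTneq x_gt0 => xw0.
have /eqP := xE w; rewrite xw0 mulr0 psumr_eq0 //.
move=> /allP /(_ v1 (mem_index_enum v1)).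
by rewrite eq_sym v1'w coedge_sym v1w => /eqP ->; rewrite ltxx.
Qed.

End OneHypergraph.

Lemma neighbor_sum_iso (H1 H2 : hypergraph) (f : H1 -> H2) (x : H2 -> C) v :
    bijective f -> (forall e : {set H1}, (f @: e \in edges H2) = (e \in edges H1)) ->
  neighbor_sum (x \o f) v = neighbor_sum x (f v).
Proof.
move=> f_bij fE; have f_inj := bij_inj f_bij.
rewrite /neighbor_sum [RHS](reindex f) /=; last exact: onW_bij.
apply: eq_bigl => w; rewrite inj_eq // (coedge_iso f_inj fE) // => y.
by have [g _ gK] := f_bij; exists (g y).
Qed.

Lemma scaled_radius_iso_le (H1 H2 : hypergraph) (v0 : H1) :
  hypergraph_iso H1 H2 -> scaled_radius m H2 <= scaled_radius m H1.
Proof.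
move=> [f f_bij fE].
have [x [x_ge0 [v xv]] xE] := nonneg_eigenvector (f v0).
have [g fK gK] := f_bij.
rewrite -(ger0_norm (scaled_radius_ge0 (f v0))).
apply: (eigen_le_scaled_radius v0 (x := x \o f)) => [|w].
  by exists (g v); rewrite /= gK gt_eqF.
by rewrite neighbor_sum_iso // xE.
Qed.

Lemma scaled_radius_iso (H1 H2 : hypergraph) (v0 : H1) :
  hypergraph_iso H1 H2 -> scaled_radius m H1 = scaled_radius m H2.
Proof.
move=> iso12; have [f _ _] := iso12; apply: le_anti.
rewrite (scaled_radius_iso_le v0 iso12) andbT.
exact: scaled_radius_iso_le (f v0) (hypergraph_iso_sym iso12).
Qed.

End Adjacency.

(** * Neighbor sums and the quadratic form of a power hypergraph *)

Section NeighborSums.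
Variables (m : nat) (V I : finType) (a b : I -> V).
Hypothesis ab_simple : simple_ends a b.
Variables (C : numClosedFieldType) (x : ipower m a b -> C).

Definition new_sum (i : I) : C := \sum_j x (inr (i, j)).

Lemma neighbor_sum_edges (v : ipower m a b) :
  neighbor_sum x v =
    \sum_(i | in_ipower_edge a b i v) \sum_(w | (v != w) && in_ipower_edge a b i w) x w.
Proof.
rewrite (exchange_big_dep (fun w => v != w)) /=; last by move=> i w _ /andP[].
rewrite /neighbor_sum big_mkcondr /=; apply: eq_bigr => w vw.
rewrite coedge_ipower; case: existsP => [[i /andP[vi wi]]|no_i].
  rewrite (big_pred1 i) // => j; rewrite vw /=; apply/andP/eqP => [[vj wj]|->//].
  exact: (ipower_edge_uniq ab_simple vw).
rewrite big_pred0 // => i; rewrite vw; apply/negP => vwi.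
by case: no_i; exists i.
Qed.

Lemma edge_sum (i : I) :
  \sum_(z | in_ipower_edge a b i z) x z = x (inl (a i)) + x (inl (b i)) + new_sum i.
Proof.
have [ab_neq _] := ab_simple.
rewrite big_sumType /=; congr (_ + _).
  rewrite (bigD1 (a i)) ?eqxx //=; congr (_ + _).
  rewrite (big_pred1 (b i)) // => v /=.
  have [->|] := eqVneq v (a i); first by rewrite (negbTE (ab_neq i)).
  by rewrite andbT.
rewrite (eq_big (fun q => (q.1 == i) && true) (fun q => x (inr (q.1, q.2)))).
- rewrite -(pair_big (fun i' => i' == i) predT (fun i' j => x (inr (i', j)))) /=.
  by rewrite big_pred1_eq.
- by move=> q; rewrite andbT.
by case.
Qed.

Lemma edge_sum_neq (i : I) (v : ipower m a b) : in_ipower_edge a b i v ->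
  \sum_(w | (v != w) && in_ipower_edge a b i w) x w =
    x (inl (a i)) + x (inl (b i)) + new_sum i - x v.
Proof.
move=> vi; rewrite -edge_sum [in RHS](bigD1 v) //= [RHS]addrC addKr.
by apply: eq_bigl => w; rewrite andbC eq_sym.
Qed.

Lemma neighbor_sum_new (i : I) (j : 'I_(m - 2)) :
  neighbor_sum x (inr (i, j)) =
    x (inl (a i)) + x (inl (b i)) + new_sum i - x (inr (i, j)).
Proof.
rewrite neighbor_sum_edges (big_pred1 i) => [|i'] /=; last exact: eq_sym.
by rewrite edge_sum_neq //= eqxx.
Qed.

Lemma neighbor_sum_core (v : V) :
  neighbor_sum x (inl v) =
    (\sum_(i | v == a i) (x (inl (b i)) + new_sum i)) +
     \sum_(i | v == b i) (x (inl (a i)) + new_sum i).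
Proof.
have [ab_neq _] := ab_simple.
rewrite neighbor_sum_edges (bigID (fun i => v == a i)) /=; congr (_ + _).
  apply: eq_big => [i|i /andP[_ /eqP vE]].
    by rewrite andb_idl // => ->.
  by rewrite edge_sum_neq /= vE ?eqxx //; ring.
apply: eq_big => [i|i /andP[/orP[-> //|/eqP vE _]]].
  have [->|] := eqVneq v (a i); first by rewrite /= (negbTE (ab_neq i)).
  by rewrite andbT.
by rewrite edge_sum_neq /= vE ?eqxx ?orbT //; ring.
Qed.

(** An edge contributes the square of its total weight minus the squares of its entries. The
    factored form isolates the dependence on each end, so monotonicity under moving [b i] is
    visible. *)
Lemma quadratic_form_ipower :
  \sum_v x v * neighbor_sum x v =
    \sum_i (2 * (x (inl (a i)) + new_sum i) * (x (inl (b i)) + new_sum i)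
             - new_sum i ^+ 2 - \sum_j x (inr (i, j)) ^+ 2).
Proof.
rewrite big_sumType /=.
under eq_bigr do rewrite neighbor_sum_core mulrDr.
rewrite big_split /=.
have coreE (c : I -> V) (F : I -> C) :
  \sum_v x (inl v) * (\sum_(i | v == c i) F i) = \sum_i x (inl (c i)) * F i.
  under eq_bigr do rewrite mulr_sumr.
  rewrite (exchange_big_dep predT) //=; apply: eq_bigr => i _.
  by rewrite (big_pred1 (c i)).
rewrite !coreE.
rewrite (eq_bigr (fun q => x (inr (q.1, q.2)) * (x (inl (a q.1)) + x (inl (b q.1))
   + new_sum q.1) - x (inr (q.1, q.2)) ^+ 2)) => [|[i j] _]; last first.
  by rewrite neighbor_sum_new /=; ring.
rewrite -(pair_bigA _ (fun i j => x (inr (i, j)) * (x (inl (a i)) + x (inl (b i))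
   + new_sum i) - x (inr (i, j)) ^+ 2)) /= -!big_split /=.
apply: eq_bigr => i _; rewrite sumrB -mulr_suml -/(new_sum i); ring.
Qed.

End NeighborSums.

(** * The spectral radius of the extremal hypergraph *)

Section WindmillSpectrum.
Variables (C : numClosedFieldType) (m : nat) (V : finType) (u : V) (c d : bool -> V).
Hypothesis m_ge2 : (2 <= m)%N.
Let core_seq := [:: u; c false; d false; c true; d true].
Hypothesis core_uniq : uniq core_seq.
Let cu k : c k != u := windmill_c_neq core_uniq k.
Let du k : d k != u := windmill_d_neq core_uniq k.
Local Notation cs k := (c_spoke core_uniq k).
Local Notation ds k := (d_spoke core_uniq k).
Local Notation W := (windmill m u c d).
Let l := #|[pred v | v \notin core_seq]|.

Lemma windmill_cd_neq k k' : c k != d k'.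
Proof.
move: core_uniq; rewrite /= !inE !negb_or.
move=> /and5P[_ /and3P[n1 n2 n3] /andP[n4 n5] n6 _].
by case: k; case: k'; rewrite // eq_sym.
Qed.

Lemma windmill_c_inj : injective c.
Proof.
move: core_uniq; rewrite /= !inE !negb_or.
move=> /and5P[_ /and3P[_ n2 _] _ _ _].
by case=> -[] // /eqP; rewrite ?(negbTE n2) // eq_sym (negbTE n2).
Qed.

Lemma windmill_d_inj : injective d.
Proof.
move: core_uniq; rewrite /= !inE !negb_or.
move=> /and5P[_ _ /andP[_ n2] _ _].
by case=> -[] // /eqP; rewrite ?(negbTE n2) // eq_sym (negbTE n2).
Qed.

Lemma windmill_simple : simple_ends (@windmill_a V u c) (@windmill_b V u d).
Proof.
split=> [[v|k]|[v|k] [w|k']] /=; first exact: (valP v); first exact: windmill_cd_neq.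
- case/set2_eqP => -[vw uw]; first by congr inl; apply: val_inj.
  by case/negP: (valP v); apply/eqP.
- by case/set2_eqP => -[_ /eqP]; rewrite eq_sym ?(negbTE (du _)) ?(negbTE (cu _)).
- case/set2_eqP => -[]; first by move=> _ /eqP; rewrite (negbTE (du _)).
  by move/eqP; rewrite (negbTE (cu _)).
by case/set2_eqP => -[]; [move/windmill_c_inj-> | move/eqP;
  rewrite (negbTE (windmill_cd_neq _ _))].
Qed.

Lemma windmill_connected : connected_hypergraph W.
Proof.
have sym := sym_connect_sym (@coedge_sym W).
have edge_conn i (v w : W) : in_ipower_edge (@windmill_a V u c) (@windmill_b V u d) i
  v ->
    in_ipower_edge (@windmill_a V u c) (@windmill_b V u d) i w ->
      connect (coedge W) v w.
  by move=> vi wi; apply: connect1; rewrite coedge_ipower; apply/existsP; exists i;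
    rewrite vi.
have core_u v : connect (coedge W) (inl v) (inl u).
  have [->|vu] := eqVneq v u; first exact: connect0.
  by apply: (edge_conn (inl (Sub v vu))); rewrite /= eqxx ?orbT.
have to_u (z : W) : connect (coedge W) z (inl u).
  case: z => [v|[i j]]; first exact: core_u.
  apply: connect_trans (core_u (windmill_a c i)).
  by apply: (edge_conn i); rewrite /= eqxx.
by move=> v w; apply: connect_trans (to_u v) _; rewrite sym.
Qed.

Lemma sum_spokes (R : nmodType) (F : spoke u -> R) :
  \sum_v F v = F (cs false) + F (ds false) + F (cs true) + F (ds true)
    + \sum_(v : spoke u | val v \notin core_seq) F v.
Proof.
pose s : seq (spoke u) := [:: cs false; ds false; cs true; ds true].
have s_uniq : uniq s.
  by rewrite -(map_inj_uniq val_inj); have /andP[] := core_uniq.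
have sE v : (v \in s) = (val v \in core_seq).
  by rewrite -(mem_map val_inj) !inE (negbTE (valP v)).
rewrite (bigID (fun v => val v \in core_seq)) /=; congr (_ + _).
under eq_bigl do rewrite -sE.
by rewrite -big_uniq //= !big_cons big_nil addr0 !addrA.
Qed.

Lemma card_pendant_spokes : #|[pred v : spoke u | val v \notin core_seq]| = l.
Proof.
rewrite -(card_image val_inj); apply: eq_card => v; rewrite inE.
apply/imageP/idP => [[w + ->]|v_out]; first by rewrite inE.
have vu : v != u by move: v_out; rewrite inE negb_or => /andP[].
by exists (Sub v vu).
Qed.

Lemma sum_spokes_const (F : spoke u -> C) (q : C) :
    (forall v : spoke u, val v \notin core_seq -> F v = q) ->
  \sum_v F v = F (cs false) + F (ds false) + F (cs true) + F (ds true) + l%:R * q.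
Proof.
move=> F_pend; rewrite sum_spokes; congr (_ + _).
rewrite (eq_bigr (fun => q)) // sumr_const -card_pendant_spokes mulr_natl.
by congr (_ *+ _); apply: eq_card.
Qed.

Section Equations.
Variable x : W -> C.
Let N := @new_sum m V (spoke u + bool)%type (@windmill_a V u c) (@windmill_b V u d) C x.

Let sum_a (v : V) (vu : v != u) (G : spoke u + bool -> C) :
  \sum_(i | v == windmill_a c i) G i = G (inl (Sub v vu)) + \sum_(k | v == c k) G
    (inr k).
Proof.
by rewrite big_sumType /= (big_pred1 (Sub v vu)).
Qed.

Let sum_b (v : V) (vu : v != u) (G : spoke u + bool -> C) :
  \sum_(i | v == windmill_b d i) G i = \sum_(k | v == d k) G (inr k).
Proof.
by rewrite big_sumType /= (negbTE vu) big_pred0_eq add0r.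
Qed.

Lemma neighbor_sum_pendant (v : spoke u) : val v \notin core_seq ->
  neighbor_sum x (inl (val v)) = x (inl u) + N (inl v).
Proof.
move=> v_out; have := neighbor_sum_core windmill_simple x (val v).
rewrite (sum_a (valP v)) (sum_b (valP v)) => ->.
have nv k : (val v == c k) = false /\ (val v == d k) = false.
  move: v_out; rewrite !inE !negb_or => /and5P[_ n1 n2 n3 n4].
  by case: k; split; apply/negbTE.
rewrite !big_pred0 ?addr0 => [|k|k]; try by case: (nv k).
by have -> : Sub (val v) (valP v) = v by apply: val_inj.
Qed.

Lemma neighbor_sum_c k :
  neighbor_sum x (inl (c k)) = x (inl u) + N (inl (cs k)) + (x (inl (d k)) + N (inr k)).
Proof.
rewrite (neighbor_sum_core windmill_simple) (sum_a (cu k)) (sum_b (cu k)).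
rewrite (big_pred1 k) => [|k']; last by rewrite /= (inj_eq windmill_c_inj) eq_sym.
rewrite big_pred0 ?addr0 // => k'; exact/negbTE/windmill_cd_neq.
Qed.

Lemma neighbor_sum_d k :
  neighbor_sum x (inl (d k)) = x (inl u) + N (inl (ds k)) + (x (inl (c k)) + N (inr k)).
Proof.
rewrite (neighbor_sum_core windmill_simple) (sum_a (du k)) (sum_b (du k)).
rewrite big_pred0 => [|k']; last by rewrite eq_sym; apply/negbTE/windmill_cd_neq.
by rewrite addr0 (big_pred1 k) // => k'; rewrite /= (inj_eq windmill_d_inj) eq_sym.
Qed.

Lemma neighbor_sum_center :
  neighbor_sum x (inl u) = \sum_(v : spoke u) (x (inl (val v)) + N (inl v)).
Proof.
rewrite (neighbor_sum_core windmill_simple) !big_sumType /=.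
rewrite [X in X + _ + _]big_pred0 => [|v]; last by rewrite eq_sym;
  apply/negbTE/(valP v).
rewrite [X in _ + X + _]big_pred0 => [|k]; last by rewrite eq_sym; apply/negbTE/cu.
rewrite [X in _ + (_ + X)]big_pred0 => [|k]; last by rewrite eq_sym; apply/negbTE/du.
by rewrite !add0r addr0; apply: eq_bigl => v; rewrite eqxx.
Qed.

(** Summing the eigenvalue equation over the new vertices of an edge involves only their total, so
    their entries need not be known to agree. No division is made, so that the relation holds at
    every [z]. *)
Lemma windmill_new_sum z i :
    (forall j, neighbor_sum x (inr (i, j)) = z * x (inr (i, j))) ->
  (z - m%:R + 3) * N i =
    (m%:R - 2) * (x (inl (windmill_a c i)) + x (inl (windmill_b d i))).
Proof.
move=> xE; have m2E : (m - 2)%:R = m%:R - 2 :> C by rewrite natrB.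
have : \sum_(j < m - 2) neighbor_sum x (inr (i, j)) = z * N i.
  by rewrite mulr_sumr; apply: eq_bigr => j _.
under eq_bigr do rewrite (neighbor_sum_new windmill_simple) -/(N i).
rewrite sumrB sumr_const card_ord -[\sum_j x (inr (i, j))]/(N i) -[(_ + _ + _) *+
  _]mulr_natl m2E => eqN.
have -> : (z - m%:R + 3) * N i = z * N i - (m%:R - 3) * N i by ring.
by rewrite -eqN; ring.
Qed.

(** The quadratic factor in the quintic; it arises on adding the equations at the two outer vertices
    of a triangle. *)
Definition inner_poly (z : C) : C := z ^+ 2 - (m%:R - 2) * z - 2 * m%:R + 3.

Lemma windmill_eigen_triangle z k : (forall w, neighbor_sum x w = z * x w) ->
  inner_poly z * (x (inl (c k)) + x (inl (d k))) = 2 * (z + 1) * x (inl u).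
Proof.
move=> xE; have NE i : _ := windmill_new_sum (fun j => xE (inr (i, j))).
have := neighbor_sum_c k; have := neighbor_sum_d k; rewrite !xE.
have /= := NE (inl (cs k)); have /= := NE (inl (ds k)); have /= := NE (inr k).
set D := z - m%:R + 3; set xc := x (inl (c k)); set xd := x (inl (d k)).
set xu := x (inl u); set Nc := N (inl (cs k)); set Nd := N (inl (ds k)).
set Ng := N (inr k) => gE dE cE xdE xcE.
have : D * (z * xc + z * xd) = D * (xu + Nc + (xd + Ng)) + D * (xu + Nd + (xc + Ng)).
  by rewrite xcE xdE mulrDr.
have -> : D * (xu + Nc + (xd + Ng)) + D * (xu + Nd + (xc + Ng)) =
    2 * (D * xu) + D * (xc + xd) + D * Nc + D * Nd + 2 * (D * Ng) by ring.
rewrite gE dE cE /D /inner_poly => eqD; apply/eqP; rewrite -subr_eq0; apply/eqP.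
move/eqP: eqD; rewrite -subr_eq0 => /eqP eqD; rewrite -[RHS]eqD; ring.
Qed.

Lemma windmill_eigen_pendant z (v : spoke u) : (forall w, neighbor_sum x w = z * x w) ->
    val v \notin core_seq ->
  (z + 1) * (z - m%:R + 2) * x (inl (val v)) = (z + 1) * x (inl u).
Proof.
move=> xE v_out; have /= := windmill_new_sum (fun j => xE (inr (inl v, j))).
have := neighbor_sum_pendant v_out; rewrite !xE.
set D := z - m%:R + 3; set Nv := N (inl v) => xvE NE.
have : D * (z * x (inl (val v))) = D * (x (inl u) + Nv) by rewrite xvE.
rewrite mulrDr NE /D => eqD; apply/eqP; rewrite -subr_eq0; apply/eqP.
move/eqP: eqD; rewrite -subr_eq0 => /eqP eqD; rewrite -[RHS]eqD; ring.
Qed.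

Lemma windmill_eigen_center z : (forall w, neighbor_sum x w = z * x w) ->
  (z - m%:R + 3) * z * x (inl u) =
    (z + 1) * (\sum_(v : spoke u) x (inl (val v))) + (m%:R - 2) * (l%:R + 4) * x (inl
      u).
Proof.
move=> xE; have := neighbor_sum_center; rewrite xE -mulrA => ->.
rewrite mulr_sumr.
under eq_bigr do rewrite mulrDr (windmill_new_sum (fun j => xE (inr (inl _, j)))) /=.
rewrite (eq_bigr (fun v => (z + 1) * x (inl (val v)) + (m%:R - 2) * x (inl u))).
  rewrite big_split /= -mulr_sumr; congr (_ + _).
  by rewrite (sum_spokes_const (q := (m%:R - 2) * x (inl u))) //; ring.
by move=> v _; ring.
Qed.

(** Multiplying the equation at the centre by [(z - m + 2) * inner_poly z] turns each leaf entry
    into a multiple of the entry at [u]. Cancelling [z + 1] in the pendant relation requires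
    [z + 1 != 0]. *)
Lemma windmill_eigen_BC_poly z : (forall w, neighbor_sum x w = z * x w) ->
  z + 1 != 0 -> BC_poly m (l + 6) z * x (inl u) = 0.
Proof.
move=> xE z1; have centerE := windmill_eigen_center xE.
have fE := windmill_eigen_triangle false xE; have tE := windmill_eigen_triangle true xE.
have pE (v : spoke u) : val v \notin core_seq ->
    (z - m%:R + 2) * x (inl (val v)) = x (inl u).
  move=> v_out; apply: (mulfI z1); rewrite mulrA.
  exact: windmill_eigen_pendant.
have sumE := sum_spokes_const (F := fun v => (z - m%:R + 2) * x (inl (val v))) pE.
move: sumE; rewrite -mulr_sumr /= => sumE.
have cE : (z - m%:R + 2) * inner_poly z * ((z - m%:R + 3) * z * x (inl u)) =
  (z + 1) * (inner_poly z * ((z - m%:R + 2) * (\sum_(v : spoke u) x (inl (val v)))))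
  + (z - m%:R + 2) * inner_poly z * ((m%:R - 2) * (l%:R + 4) * x (inl u)).
  by rewrite centerE; ring.
move: cE; rewrite sumE.
have -> : inner_poly z * ((z - m%:R + 2) * x (inl (c false)) + (z - m%:R + 2) * x
  (inl (d false)) +
    (z - m%:R + 2) * x (inl (c true)) + (z - m%:R + 2) * x (inl (d true)) + l%:R * x
      (inl u)) =
  (z - m%:R + 2) * (inner_poly z * (x (inl (c false)) + x (inl (d false)))
    + inner_poly z * (x (inl (c true)) + x (inl (d true)))) + inner_poly z * l%:R * x
      (inl u).
  ring.
rewrite fE tE /inner_poly /BC_poly natrD => /eqP; rewrite -subr_eq0 => /eqP eq0.
by rewrite -[RHS]eq0; ring.
Qed.

End Equations.

Let r : C := scaled_radius C m W.

Lemma inner_polyE (z : C) :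
  inner_poly z = z * (z - m%:R + 2) - (2 * m%:R - 3).
Proof. by rewrite /inner_poly; ring. Qed.

Let m2_ge0 : 0 <= m%:R - 2 :> C.
Proof. by rewrite subr_ge0 ler_nat. Qed.

Let inner_const_ge1 : 1 <= 2 * m%:R - 3 :> C.
Proof.
rewrite -subr_ge0; have -> : 2 * m%:R - 3 - 1 = 2 * (m%:R - 2) :> C by ring.
by rewrite mulr_ge0.
Qed.

Lemma windmill_radius_root :
  [/\ 0 < r, 0 < r - m%:R + 2, 0 < inner_poly r & BC_poly m (l + 6) r = 0].
Proof.
have [x x_gt0 xE] := perron_eigenvector C m_ge2 (inl u : W) windmill_connected.
have r_ge0 : 0 <= r by exact: (scaled_radius_ge0 C m_ge2 (inl u : W)).
have r1_gt0 : 0 < r + 1 by rewrite ltr_wpDl.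
(* For a positive eigenvector, both the right side of the triangle relation and the cofactor of
   [inner_poly r] are positive. *)
have Q_gt0 : 0 < inner_poly r.
  have := windmill_eigen_triangle false xE; rewrite -/r => triE.
  have : 0 < inner_poly r * (x (inl (c false)) + x (inl (d false))).
    by rewrite triE !mulr_gt0.
  by rewrite pmulr_lgt0 // addr_gt0.
have rD_gt0 : 0 < r * (r - m%:R + 2).
  move: Q_gt0; rewrite inner_polyE subr_gt0; apply: lt_trans.
  exact: lt_le_trans ltr01 inner_const_ge1.
have r_gt0 : 0 < r.
  rewrite lt_def r_ge0 andbT; apply: contraTneq rD_gt0 => ->.
  by rewrite mul0r ltxx.
split=> //; first by rewrite -(pmulr_rgt0 _ r_gt0).
have /eqP := windmill_eigen_BC_poly xE (lt0r_neq0 r1_gt0).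
by rewrite mulf_eq0 [x _ == 0]gt_eqF // orbF => /eqP.
Qed.

Lemma windmill_radius_ge1 : 1 <= r.
Proof.
have [r_gt0 D_gt0 Q_gt0 _] := windmill_radius_root.
have [//|r_lt1] := real_leP (ger0_real ler01) (ger0_real (ltW r_gt0)).
have : r * (r - m%:R + 2) < 1.
  rewrite -[X in _ < X]mulr1 ltr_pM ?ltW //.
  by apply: le_lt_trans r_lt1; rewrite -addrA gerDl addrC -opprB oppr_le0.
move=> /lt_le_trans /(_ inner_const_ge1) lt_const.
by move: Q_gt0; rewrite inner_polyE subr_gt0 => /lt_trans /(_ lt_const); rewrite ltxx.
Qed.

(* The exceptional roots are those at which the eigenvector below degenerates. *)
Lemma windmill_other_root_le z : BC_poly m (l + 6) z = 0 -> `|z| <= r.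
Proof.
move=> z_root; have [r_gt0 D_gt0 _ _] := windmill_radius_root.
have r_ge1 := windmill_radius_ge1.
have le_m2 : m%:R - 2 <= r.
  by rewrite -subr_ge0 opprB addrA addrAC ltW.
have [zE|D1_neq0] := eqVneq (z - m%:R + 2) 0.
  have -> : z = m%:R - 2 by rewrite -[LHS]subr0 -zE; ring.
  by rewrite ger0_norm.
have [zE|z1_neq0] := eqVneq (z + 1) 0.
  have -> : z = - 1 by rewrite -[LHS]subr0 -zE; ring.
  by rewrite normrN1.
(* The value [m - 3] may be negative: it equals [-1] for [m = 2], which [1 <= r] covers. *)
have [zE|D_neq0] := eqVneq (z - m%:R + 3) 0.
  have -> : z = m%:R - 3 by rewrite -[LHS]subr0 -zE; ring.
  rewrite real_ler_norml ?rpredB ?realn //; apply/andP; split.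
    apply: (@le_trans _ _ (- 1)); first by rewrite lerN2.
    by rewrite -subr_ge0; have -> : m%:R - 3 - - 1 = m%:R - 2 :> C by ring.
  by apply: le_trans le_m2; rewrite lerD2l lerN2 ler_nat.
(* Here the quintic reduces to [- 4 * (z + 1) ^+ 2 * (z - m + 2)], whose zeros are already
   excluded. *)
have [zE|Q_neq0] := eqVneq (inner_poly z) 0.
  move/eqP: z_root; rewrite /BC_poly -[X in _ * X - _]/(inner_poly z) zE mulr0 sub0r.
  rewrite oppr_eq0 mulf_eq0 (negbTE D1_neq0) orbF mulf_eq0 sqrf_eq0 (negbTE z1_neq0).
  by rewrite pnatr_eq0.
(* The triangle and pendant relations solved with entry [1] at [u] and equal entries at [c k] and
   [d k]; the new vertices of an edge share the value dictated by [windmill_new_sum]. *)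
pose q := (z + 1) / inner_poly z; pose p := (z - m%:R + 2)^-1.
pose h (v : V) : C := if v == u then 1 else if v \in core_seq then q else p.
pose x (w : W) : C := match w with
  | inl v => h v
  | inr (i, _) => (h (windmill_a c i) + h (windmill_b d i)) / (z - m%:R + 3)
  end.
have hu : h u = 1 by rewrite /h eqxx.
have hc k : h (c k) = q by rewrite /h (negbTE (cu k)); case: k; rewrite !inE eqxx ?orbT.
have hd k : h (d k) = q by rewrite /h (negbTE (du k)); case: k; rewrite !inE eqxx ?orbT.
have hp (v : spoke u) : val v \notin core_seq -> h (val v) = p.
  by move=> v_out; rewrite /h (negbTE (valP v)) (negbTE v_out).
have NE i : new_sum (a := windmill_a c) (b := windmill_b d) x i =
    (m%:R - 2) * ((h (windmill_a c i) + h (windmill_b d i)) / (z - m%:R + 3)).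
  by rewrite /new_sum /= sumr_const card_ord -[LHS]mulr_natl natrB.
apply: (eigen_le_scaled_radius m_ge2 (inl u : W) (x := x)).
  by exists (inl u); rewrite /= hu oner_eq0.
have Q_neq0' := Q_neq0; rewrite /inner_poly in Q_neq0'.
case=> [v|[i j]]; last first.
  rewrite (neighbor_sum_new windmill_simple) NE /=; field.
  exact: D_neq0.
have [->|vu] := eqVneq v u.
  rewrite neighbor_sum_center /= hu.
  rewrite (sum_spokes_const (q := p + (m%:R - 2) * ((p + 1) / (z - m%:R + 3))));
    last first.
    by move=> w w_out; rewrite NE /= hu hp.
  rewrite !NE /= !hc !hd hu /q /p.
  apply/eqP; rewrite -subr_eq0 mulr1.
  (* All other equations hold by the choice of entries; the defect at the centre is the quintic over
     the cleared denominators. *)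
  rewrite [X in X == 0](_ : _ = - (BC_poly m (l + 6) z /
     ((z - m%:R + 3) * (z - m%:R + 2) * inner_poly z))).
    by rewrite z_root mul0r oppr0.
  rewrite /BC_poly /inner_poly natrD; field.
  by rewrite D_neq0 D1_neq0 Q_neq0'.
have [v_core|v_out] := boolP (v \in core_seq); last first.
  have := neighbor_sum_pendant x (v := Sub v vu) v_out; rewrite SubK => ->.
  rewrite NE /= hu (hp (Sub v vu)) // /p; field.
  by rewrite D_neq0 D1_neq0.
move: v_core; rewrite inE (negbTE vu) /= => v_core.
have [k [->|->]] : exists k, v = c k \/ v = d k.
  by move: v_core; rewrite !inE => /or4P[]/eqP->;
    [exists false; left | exists false; right | exists true; left | exists true; right].
- rewrite neighbor_sum_c !NE /= !hc !hd !hu /q /inner_poly; field.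
  by rewrite D_neq0 Q_neq0'.
rewrite neighbor_sum_d !NE /= !hc !hd !hu /q /inner_poly; field.
by rewrite D_neq0 Q_neq0'.
Qed.

(** With [l + 4 = k - 2], [0 < gap] and [gap < 4 * r] are the two quadratic inequalities behind the
    bounds; [gapE] is the quintic solved for [gap]. *)
Let gap : C := r * (r - m%:R + 2) - (l%:R + 4) * (m%:R - 1).

Let gapE : (r - m%:R + 3) * gap * inner_poly r = 4 * (r + 1) * (r + m%:R - 1).
Proof.
have [_ _ _ root_r] := windmill_radius_root.
apply/eqP; rewrite -subr_eq0 -[X in _ == X]root_r; apply/eqP.
by rewrite /BC_poly /inner_poly /gap natrD; ring.
Qed.

Let D_gt0 : 0 < r - m%:R + 3.
Proof.
have [_ D1_gt0 _ _] := windmill_radius_root.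
have -> : r - m%:R + 3 = (r - m%:R + 2) + 1 by ring.
by rewrite addr_gt0.
Qed.

Lemma windmill_radius_gap_gt0 : 0 < gap.
Proof.
have [r_gt0 _ Q_gt0 _] := windmill_radius_root.
rewrite -(pmulr_rgt0 _ D_gt0) -(pmulr_lgt0 _ Q_gt0) gapE.
have m1_gt0 : 0 < m%:R - 1 :> C by rewrite subr_gt0 ltr1n.
by apply: mulr_gt0; [rewrite mulr_gt0 // addr_gt0 | rewrite -addrA addr_gt0].
Qed.

Lemma windmill_radius_gap_lt : gap < 4 * r.
Proof.
have [r_gt0 _ Q_gt0 _] := windmill_radius_root.
rewrite -subr_gt0 -(pmulr_rgt0 _ D_gt0) -(pmulr_lgt0 _ Q_gt0).
have -> : (r - m%:R + 3) * (4 * r - gap) * inner_poly r =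
    4 * (r * (r - m%:R + 3) * inner_poly r) - (r - m%:R + 3) * gap * inner_poly r.
  by ring.
rewrite gapE.
(* Then [r * (r - n) = 4 * (n + 1) + eps] and [inner_poly r = eps + 2 * n + 3], so the difference
   becomes a polynomial in [r], [n], [eps] with positive coefficients. *)
pose n : C := m%:R - 2; pose eps := gap + l%:R * (n + 1).
have n_ge0 : 0 <= n := m2_ge0.
have eps_gt0 : 0 < eps.
  by apply: ltr_pwDl; [exact: windmill_radius_gap_gt0 | rewrite mulr_ge0 // addr_ge0].
have -> : 4 * (r * (r - m%:R + 3) * inner_poly r) - 4 * (r + 1) * (r + m%:R - 1) =
    4 * (r * (1 + eps) + ((1 + n) * (7 + 8 * n) + eps * (6 * n + 6) + eps ^+ 2)).
  by rewrite /eps /gap /n /inner_poly; ring.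
clearbody eps n; apply: mulr_gt0 => //; apply: addr_gt0.
  by rewrite mulr_gt0 // addr_gt0.
apply: ltr_pwDr; first by rewrite exprn_gt0.
by rewrite addr_ge0 // mulr_ge0 ?addr_ge0 ?mulr_ge0 // ltW.
Qed.

End WindmillSpectrum.

(** * Comparison *)

Section Isomorphisms.

Lemma loose_cycle_imset (T1 T2 : finType) (f : T1 -> T2) (D : {set {set T1}}) :
  injective f -> is_loose_cycle D -> is_loose_cycle [set f @: e | e : {set T1} in D].
Proof.
move=> f_inj [l [e [v [l3 [e_inj ->] v_inj cap disj]]]].
exists l, (fun i => f @: e i), (fun i => f (v i)); split=> //.
- split; first by move=> i j /(imset_inj f_inj) /e_inj.
  by rewrite -imset_comp.
- by move=> i j /f_inj /v_inj.
- by move=> i; rewrite -imsetI ?cap ?imset_set1 // => ? ? _ _; apply: f_inj.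
by move=> i j ji jS iS; rewrite imset_disjoint // disj.
Qed.

Lemma bicyclic_iso (H1 H2 : hypergraph) :
  hypergraph_iso H1 H2 -> bicyclic H1 -> bicyclic H2.
Proof.
move=> [f [g fK gK] fE] [C1 [C2 [C12 C_all]]].
pose F (D : {set {set H1}}) := [set f @: e | e : {set H1} in D].
pose G (D : {set {set H2}}) := [set g @: e | e : {set H2} in D].
have f_inj := can_inj fK; have g_inj := can_inj gK.
have fgK (e : {set H2}) : f @: (g @: e) = e.
  by rewrite -imset_comp (eq_imset (g := id)) ?imset_id.
have GK D : F (G D) = D.
  by rewrite /F /G -imset_comp (eq_imset (g := id)) ?imset_id.
have F_inj : injective F by apply/imset_inj/imset_inj.
exists (F C1), (F C2); split; first by rewrite (inj_eq F_inj).
have F_cyc (D : {set {set H1}}) : D \subset edges H1 /\ is_loose_cycle D ->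
    F D \subset edges H2 /\ is_loose_cycle (F D).
  move=> [/subsetP D_sub D_cyc]; split; last exact: loose_cycle_imset.
  by apply/subsetP => _ /imsetP [e eD ->]; rewrite fE D_sub.
move=> D; split=> [[/subsetP D_sub D_cyc]|[] ->].
- have /C_all : G D \subset edges H1 /\ is_loose_cycle (G D).
    split; last exact: loose_cycle_imset.
    by apply/subsetP => _ /imsetP [e eD ->]; rewrite -fE fgK D_sub.
  by move=> [] GD; [left|right]; rewrite -GD GK.
- by apply: F_cyc; apply/C_all; left.
by apply: F_cyc; apply/C_all; right.
Qed.

Lemma connected_iso (H1 H2 : hypergraph) :
  hypergraph_iso H1 H2 -> connected_hypergraph H1 -> connected_hypergraph H2.
Proof.
move=> [f f_bij fE] conn1 v w; have [g fK gK] := f_bij.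
have coE := coedge_iso (bij_inj f_bij) fE (fun y => ex_intro _ (g y) (esym (gK y))).
have /connectP [s] := conn1 (g v) (g w).
rewrite -[in connect _ v w](gK v) -[in connect _ _ w](gK w).
elim: s (g v) => [|y s IH] x /=; first by move=> _ ->; apply: connect0.
move=> /andP[xy ys] /(IH y ys); apply: connect_trans.
by apply: connect1; rewrite coE.
Qed.

Lemma card_edges_iso (H1 H2 : hypergraph) :
  hypergraph_iso H1 H2 -> #|edges H1| = #|edges H2|.
Proof.
move=> [f [g fK gK] fE]; have f_inj := can_inj fK.
rewrite -(card_imset _ (imset_inj f_inj)); apply: eq_card => e.
apply/imsetP/idP => [[e1 e1H ->]|eH]; first by rewrite fE.
have eE : e = f @: (g @: e).
  by rewrite -imset_comp (eq_imset (g := id)) ?imset_id.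
by exists (g @: e); rewrite // -fE -eE.
Qed.

Variables (m : nat) (V : finType).

Section Reindexing.
Variables (I J : finType) (a b : I -> V) (a' b' : J -> V) (tau : J -> I).
Hypotheses (ab_simple : simple_ends a b) (tau_bij : bijective tau)
  (tau_ends : forall j, [set a (tau j); b (tau j)] = [set a' j; b' j]).

Definition reindex_map (z : ipower m a' b') : ipower m a b :=
  match z with inl v => inl v | inr q => inr (tau q.1, q.2) end.

Lemma reindex_bij : bijective reindex_map.
Proof.
have [s tauK sK] := tau_bij.
exists (fun z : ipower m a b => match z with
  | inl v => inl v | inr q => inr (s q.1, q.2) end : ipower m a' b').
  by case=> [v|[j k]] //=; rewrite tauK.
by case=> [v|[j k]] //=; rewrite sK.
Qed.

Lemma reindex_edge j : reindex_map @: ipower_edge m a' b' j = ipower_edge m a b (tau j).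
Proof.
have endE v : (v == a (tau j)) || (v == b (tau j)) = (v == a' j) || (v == b' j).
  by have /setP /(_ v) := tau_ends j; rewrite !inE.
apply/setP => z; apply/imsetP/idP => [[y + ->]|].
  by case: y => [v|[i k]]; rewrite !inE /= ?endE // => /eqP ->.
case: z => [v|[i k]]; rewrite !inE /= ?endE => zi.
  by exists (inl v); rewrite ?inE.
by exists (inr (j, k)); rewrite ?inE //= (eqP zi).
Qed.

Lemma reindex_edges (e : {set ipower m a' b'}) :
  (reindex_map @: e \in edges (ipower m a b)) = (e \in edges (ipower m a' b')).
Proof.
have [s tauK sK] := tau_bij.
apply/ipower_edgesP/ipower_edgesP => [[i eE]|[j ->]].
  exists (s i); apply: (imset_inj (bij_inj reindex_bij)).
  by rewrite eE reindex_edge sK.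
by exists (tau j); rewrite reindex_edge.
Qed.

Lemma reindex_iso : hypergraph_iso (ipower m a' b') (ipower m a b).
Proof. by exists reindex_map; [exact: reindex_bij | exact: reindex_edges]. Qed.

Lemma reindex_simple : simple_ends a' b'.
Proof.
have [ab_neq ab_inj] := ab_simple; split=> [j|i j eq_ij].
  have := cards2 (a' j) (b' j); rewrite -tau_ends cards2 ab_neq.
  by case: (a' j != b' j).
by apply: (bij_inj tau_bij); apply: ab_inj; rewrite !tau_ends.
Qed.

End Reindexing.

Lemma card_ipower_edges (I : finType) (a b : I -> V) : simple_ends a b ->
  #|edges (ipower m a b)| = #|I|.
Proof. by move=> ab_simple; rewrite card_imset //; exact: ipower_edge_inj. Qed.

End Isomorphisms.

Lemma power_hypergraph_ipower (m : nat) (G : hypergraph) : uniform 2 G ->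
  exists (I : finType) (a b : I -> G), simple_ends a b /\
    hypergraph_iso (power_hypergraph m G) (ipower m a b).
Proof.
move=> G2; pose I : finType := {e : {set G} | e \in edges G}.
have ends_ex (e : I) : exists q : G * G, (q.1 != q.2) && (val e == [set q.1; q.2]).
  have /eqP := G2 _ (valP e); case/cards2P => x [y [xy eE]].
  by exists (x, y); rewrite xy; apply/eqP; exact: eE.
have [q qE] := fin_all_exists ends_ex.
pose a e := (q e).1; pose b e := (q e).2.
have valE e : val e = [set a e; b e] by have /andP[_ /eqP] := qE e.
exists I, a, b; split.
  split=> [e|e e']; first by have /andP[] := qE e.
  by rewrite -!valE => /val_inj.
have edgeE e : power_edge m e = ipower_edge m a b e.
  apply/setP => z; rewrite !inE; case: z => [v|[e' j]] /=.
    rewrite mem_imset; last exact: inl_inj.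
    rewrite valE !inE; case: imsetP => [[]//|_]; exact: orbF.
  rewrite (_ : (inr (e', j) \in _) = false) /=; last by apply/imsetP => -[].
  apply/imsetP/eqP => [[j' _ [-> _]]//|->]; by exists j.
exists id; first by exists id.
move=> e; rewrite imset_id.
by apply/ipower_edgesP/imsetP => [[i ->]|[i _ ->]]; exists i; rewrite ?edgeE.
Qed.

Section Comparison.
Variables (C : numClosedFieldType) (m : nat) (V : finType) (u : V) (c d : bool -> V).
Variables (p : V -> V).
Hypothesis m_ge2 : (2 <= m)%N.
Hypothesis core_uniq : uniq [:: u; c false; d false; c true; d true].

(** Differs from [windmill_b] only in that a spoke ends at [p] of its vertex instead of [u]. *)
Definition parent_b (z : spoke u + bool) : V :=
  match z with inl v => p (val v) | inr k => d k end.

Let a := @windmill_a V u c.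
Hypothesis parent_simple : simple_ends a parent_b.

Variables (x : ipower_vertex m V (spoke u + bool)%type -> C) (r : C).
Hypotheses (x_gt0 : forall v, 0 < x v) (x_max : forall v, x (inl v) <= x (inl u))
  (xE : forall v : ipower m a parent_b, neighbor_sum (H :=
    ipower m a parent_b) x v = r * x v).

Let W := windmill m u c d.
Let N := @new_sum m V (spoke u + bool)%type a parent_b C x.

Let N_ge0 i : 0 <= N i.
Proof. by apply: sumr_ge0 => j _; apply: ltW. Qed.

Let quadratic_form_le :
  \sum_v x v * neighbor_sum (H := ipower m a parent_b) x v <=
  \sum_v x v * neighbor_sum (H := W) x v.
Proof.
rewrite (quadratic_form_ipower parent_simple) (quadratic_form_ipower (windmill_simple
  core_uniq)).
apply: ler_sum => i _; rewrite !lerD2r -!mulrA ler_pM2l //.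
apply: ler_wpM2l; first by apply: addr_ge0; [exact: ltW | exact: N_ge0].
by case: i => [v|k] //=; rewrite lerD2r.
Qed.

Let sqr_gt0 : 0 < \sum_v x v ^+ 2.
Proof.
rewrite (bigD1 (inl u)) //= ltr_pwDl ?exprn_gt0 // sumr_ge0 // => v _.
by rewrite exprn_ge0 // ltW.
Qed.

Let x_ge0 v : 0 <= x v. Proof. exact: ltW. Qed.

Let parent_form :
  \sum_v x v * neighbor_sum (H := ipower m a parent_b) x v = r * \sum_v x v ^+ 2.
Proof.
by rewrite mulr_sumr; apply: eq_bigr => v _; rewrite xE mulrCA expr2.
Qed.

Lemma parent_radius_le : r <= scaled_radius C m W.
Proof.
rewrite -(ler_pM2r sqr_gt0) -parent_form; apply: le_trans quadratic_form_le _.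
exact: (rayleigh_le m_ge2 (inl u : W) x_ge0).
Qed.

Lemma parent_radius_eq : r = scaled_radius C m W -> forall v : spoke u, p (val v) = u.
Proof.
move=> rE.
have W_form : \sum_v x v * neighbor_sum (H := W) x v =
    scaled_radius C m W * \sum_v x v ^+ 2.
  apply/le_anti; rewrite (rayleigh_le m_ge2 (inl u : W) x_ge0) /=.
  by rewrite -rE -parent_form.
have WE := rayleigh_eq m_ge2 (inl u : W) x_ge0 W_form.
(* [x] is now an eigenvector of both hypergraphs for the same value. At [u] the windmill sums over
   all spokes, the original over those with parent [u]; every remaining spoke would add a positive
   term. *)
have := WE (inl u); rewrite -rE -xE (neighbor_sum_center core_uniq).
rewrite (neighbor_sum_core parent_simple) !big_sumType /=.
rewrite [X in X + _ + _]big_pred0 => [|v]; last by rewrite eq_sym;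
  apply/negbTE/(valP v).
rewrite [X in _ + X + _]big_pred0 => [|k]; last first.
  by rewrite eq_sym; apply/negbTE/(windmill_c_neq core_uniq).
rewrite [X in _ + (_ + X)]big_pred0 => [|k]; last first.
  by rewrite eq_sym; apply/negbTE/(windmill_d_neq core_uniq).
rewrite !add0r addr0 => sumE v; apply/eqP; rewrite eq_sym; apply: contraTT isT => pv.
move/eqP: sumE; rewrite (bigID (fun v : spoke u => u == p (val v))) /=.
rewrite -subr_eq0 addrAC subrr add0r psumr_eq0 => [|w _]; last first.
  by rewrite addr_ge0 //; exact: N_ge0.
move=> /allP /(_ v (mem_index_enum v)); rewrite pv /=.
by rewrite gt_eqF // ltr_pwDl //; exact: N_ge0.
Qed.

End Comparison.

(** Nonnegativity serves to make the entries real, hence comparable. *)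
Lemma exists_max_entry (C : numClosedFieldType) (T : finType) (v0 : T) (F : T -> C) :
  (forall v, 0 <= F v) -> exists u, forall v, F v <= F u.
Proof.
move=> F_ge0; have F_real : {in xpredT, forall v, F v \is Num.real}.
  by move=> v _; apply: ger0_real.
have [u _ u_max] := real_arg_maxP (i0 := v0) (P := xpredT) isT F_real.
by exists u => v; apply: u_max.
Qed.

(** * Comparison with the larger root of [s ^+ 2 - B * s - E] *)

Section QuadraticBounds.
Variables (C : numClosedFieldType) (B E s : C).
Hypotheses (s_gt0 : 0 < s) (E_ge0 : 0 <= E).

Lemma sqrtC_quadratic_lt : B <= s -> B \is Num.real -> 0 < s * (s - B) - E ->
  (B + sqrtC (B ^+ 2 + 4 * E)) / 2 < s.
Proof.
move=> B_le B_real gap_gt0; have t_ge0 : 0 <= 2 * s - B.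
  have -> : 2 * s - B = s + (s - B) by ring.
  by rewrite addr_ge0 ?subr_ge0 // ltW.
rewrite ltr_pdivrMr // -ltrBrDl -[X in _ < X](_ : 2 * s - B = _); last by ring.
rewrite -[X in _ < X]sqrCK // ltr_sqrtC ?nnegrE ?exprn_ge0 //; last first.
  by rewrite addr_ge0 ?real_exprn_even_ge0 // mulr_ge0.
rewrite -subr_gt0 [X in _ < X](_ : _ = 4 * (s * (s - B) - E)); last by ring.
by rewrite mulr_gt0.
Qed.

Lemma sqrtC_quadratic_gt : B \is Num.real -> s * (s - B) - E < 0 ->
  s < (B + sqrtC (B ^+ 2 + 4 * E)) / 2.
Proof.
move=> B_real gap_lt0; have s_real : s \is Num.real by apply/ger0_real/ltW.
have D_ge0 : 0 <= B ^+ 2 + 4 * E by rewrite addr_ge0 ?real_exprn_even_ge0 // mulr_ge0.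
have D_gt : (2 * s - B) ^+ 2 < B ^+ 2 + 4 * E.
  rewrite -subr_gt0 [X in _ < X](_ : _ = 4 * - (s * (s - B) - E)); last by ring.
  by rewrite mulr_gt0 // oppr_gt0.
rewrite ltr_pdivlMr // -ltrBlDl -[X in X < _](_ : 2 * s - B = _); last by ring.
have [t_ge0|t_lt0] := real_leP (real0 _) (rpredB (rpredM (realn _ 2) s_real) B_real);
  last first.
  by apply: lt_le_trans t_lt0 _; rewrite sqrtC_ge0.
by rewrite -[X in X < _]sqrCK // ltr_sqrtC ?nnegrE ?exprn_ge0.
Qed.

End QuadraticBounds.

Unset Implicit Arguments.

Theorem theorem4p0p1 (C : numClosedFieldType) (m k : nat) (H : hypergraph)
    (m_ge2 : (2 <= m)%N)
    (H_power : is_power_hypergraph m H)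
    (H_conn : connected_hypergraph H)
    (H_bicyclic : bicyclic H)
    (H_linear : linear_hypergraph H)
    (H_uniform : uniform m H)
    (H_size : #|edges H| = k) :
  (lambda1 C m H <= lambda1 C m (BC m (k - 6))
   /\ (lambda1 C m H = lambda1 C m (BC m (k - 6)) ->
       hypergraph_iso H (BC m (k - 6))))
  /\
  (exists beta : C,
     [/\ largest_root (BC_poly m k) beta,
         lambda1 C m (BC m (k - 6)) = `|beta| / (m%:R - 1),
         (m%:R - 2 + sqrtC ((m%:R - 2) ^+ 2 + 4 * (k%:R - 2) * (m%:R - 1))) / 2
           < `|beta|
       & `|beta|
           < (m%:R + 2 + sqrtC ((m%:R + 2) ^+ 2 + 4 * (k%:R - 2) * (m%:R - 1)))
             / 2]).
Proof.
have [G G2 HG] := H_power.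
have [I [a [b [ab_simple GI]]]] := power_hypergraph_ipower m G2.
have H0 := hypergraph_iso_trans HG GI.
have conn0 := connected_iso H0 H_conn; have bic0 := bicyclic_iso H0 H_bicyclic.
(* The spectral lemmas need a vertex; a loose cycle provides one, through an end of its edge if it
   is a new vertex. *)
have [v0] : exists v0 : G, True.
  have [C1 [C2 [_ /(_ C1) [_ /(_ (or_introl erefl))]]]] := bic0.
  move=> [_ [l [e [v [l3 _ _ _ _]]]]].
  by case: (v (Ordinal (ltnW (ltnW l3)))) => [w|[i _]]; [exists w | exists (a i)].
move=> _; have [x x_gt0 xE] := perron_eigenvector C m_ge2 (inl v0 : ipower m a b) conn0.
have [u u_max] := exists_max_entry v0 (fun v => ltW (x_gt0 (inl v))).
have [p [g [tau [tau_bij tau_g tau_p]]]] := bicyclic_decomposition ab_simple u conn0 bic0.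
pose c k' := a (g k'); pose d k' := b (g k').
rewrite -[uniq _]/(uniq [:: u; c false; d false; c true; d true]) => core_uniq.
pose pa : _ -> G := @windmill_a G u c; pose pb : _ -> G := @parent_b G u d p.
have tau_ends j : [set a (tau j); b (tau j)] = [set pa j; pb j].
  by case: j => [v|k'] /=; [exact: tau_p | rewrite tau_g].
have P_simple : simple_ends pa pb := reindex_simple ab_simple tau_bij tau_ends.
have P_iso : hypergraph_iso (ipower m pa pb) (ipower m a b).
  exact: (reindex_iso m tau_bij tau_ends).
pose f := @reindex_map m _ _ _ a b pa pb tau.
have f_bij : bijective f by exact: (reindex_bij m a b pa pb tau_bij).
have fE := reindex_edges (m := m) tau_bij tau_ends.
set l := #|[pred v | v \notin [:: u; c false; d false; c true; d true]]|.
set W := windmill m u c d.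
have kE : k = (l + 6)%N.
  rewrite -H_size (card_edges_iso H0) -(card_edges_iso P_iso) card_ipower_edges //.
  by rewrite card_sum card_bool (card_spoke core_uniq) -addnA.
have BCW : hypergraph_iso (BC m (k - 6)) W.
  by rewrite kE addnK; apply: BC_iso_windmill.
have m1_gt0 : 0 < m%:R - 1 :> C by rewrite subr_gt0 ltr1n.
pose r := scaled_radius C m (ipower m a b).
have x'E v : neighbor_sum (H := ipower m pa pb) (x \o f) v = r * (x \o f) v.
  by rewrite (neighbor_sum_iso x v f_bij fE) xE.
have x'_gt0 v : 0 < (x \o f) v by exact: x_gt0.
have x'_max v : (x \o f) (inl v) <= (x \o f) (inl u) by exact: u_max.
have radius_le := parent_radius_le m_ge2 core_uniq P_simple x'_gt0 x'_max x'E.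
have radius_eq := parent_radius_eq m_ge2 core_uniq P_simple x'_gt0 x'_max x'E.
have [h0' _ _] := hypergraph_iso_sym H0.
have HE : scaled_radius C m H = r.
  exact: (scaled_radius_iso C m_ge2 (h0' (inl v0)) H0).
have [w0 _ _] := hypergraph_iso_sym BCW.
have BCE : scaled_radius C m (BC m (k - 6)) = scaled_radius C m W.
  exact: (scaled_radius_iso C m_ge2 (w0 (inl u)) BCW).
split; [split|].
- rewrite -(ler_pM2l m1_gt0).
  by have := radius_le; rewrite -HE -BCE.
- move=> /(congr1 (fun t => (m%:R - 1) * t)); rewrite -/(scaled_radius C m H).
  rewrite -/(scaled_radius C m (BC m (k - 6))) HE BCE => /radius_eq p_u.
  apply: hypergraph_iso_trans (hypergraph_iso_sym BCW).
  apply: hypergraph_iso_trans H0 _; apply: hypergraph_iso_trans (hypergraph_iso_sym P_iso) _.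
  (* Once every parent is [u], the two families of ends coincide index by index. *)
  apply: (reindex_iso m (tau := id)); first by exists id.
  by case=> [v|k'] //=; rewrite p_u.
have [r_gt0 D_gt0 _ root_r] := windmill_radius_root C m_ge2 core_uniq.
have other := windmill_other_root_le m_ge2 core_uniq (C := C).
have gap_gt0 := windmill_radius_gap_gt0 C m_ge2 core_uniq.
have gap_lt := windmill_radius_gap_lt C m_ge2 core_uniq.
rewrite -/W in r_gt0 D_gt0 root_r other gap_gt0 gap_lt.
rewrite -/l -kE in root_r other.
have k2E : k%:R - 2 = l%:R + 4 :> C by rewrite kE natrD; ring.
have k2_ge0 : 0 <= k%:R - 2 :> C by rewrite k2E addr_ge0.
have norm_r : `|scaled_radius C m W| = scaled_radius C m W by rewrite gtr0_norm.
exists (scaled_radius C m W); rewrite norm_r; split.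
- by split=> // z z_root; rewrite norm_r; apply: other.
- by rewrite -BCE /scaled_radius mulrAC divff ?mul1r // gt_eqF.
(* [0 < gap] with [B = m - 2] and [E = (k - 2) * (m - 1)]. *)
- rewrite -(mulrA 4); apply: sqrtC_quadratic_lt; rewrite ?rpredB ?realn //.
  + by rewrite mulr_ge0 ?(ltW m1_gt0).
  + by rewrite -subr_ge0 opprB addrA addrAC ltW.
  by rewrite k2E opprB addrA addrAC.
(* Moving [4 * r] across [gap < 4 * r] changes [B] from [m - 2] to [m + 2]. *)
rewrite -(mulrA 4); apply: sqrtC_quadratic_gt => //.
- by rewrite mulr_ge0 ?(ltW m1_gt0).
- by apply/ger0_real/addr_ge0.
rewrite k2E -oppr_gt0 [X in _ < X](_ : _ = 4 * scaled_radius C m W -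
  (scaled_radius C m W * (scaled_radius C m W - m%:R + 2) - (l%:R + 4) * (m%:R - 1))).
  by rewrite subr_gt0.
by ring.
Qed.
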